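(* Let $\mathcal T$ denote a star-shaped tree with $N$ edges, and assume that $\alpha_1\neq N$. Then the operator $A_D$ has at least one eigenvalue if, and only if, $$\alpha_1\neq N-2.$$ Furthermore, if $\alpha_1\ne N-2$, then the discrete spectrum of $A_D$ is $\sigma_d(A_D)=\{\lambda_k:\ k\in\mathbb Z\}$, where $$\lambda_k=\frac{c_1}{2}\log_{-\frac{\pi}{2}}\frac{N-2-\alpha_1}{N-\alpha_1}+ic_1k\pi .$$ In particular, if $\alpha_1\ne N-2$, then the finite-time stabilization in $\mathcal H_0$ of the evolution system $U_t=A_DU$, $U(0)=U_0$, fails.
   Context: Setting. The star-shaped tree has $N\ge 2$ edges of length $1$, indexed by $i\in\mathcal I=\{1,\dots,N\}$ and parametrized by $x\in[0,1]$, with wave speeds $c_i>0$, and a single internal node. Edge $1$ goes from the root (an external node, $x=0$) to the internal node ($x=1$); each edge $i\in\{2,\dots,N\}$ goes from the internal node ($x=0$) to an external node ($x=1$). The system is $u_{i,tt}=c_i^2u_{i,xx}$ on each edge, with the homogeneous Dirichlet condition $u_1(0,t)=0$ at the root, transparent conditions $c_iu_{i,x}(1,t)=-u_{i,t}(1,t)$ for $2\le i\le N$, and at the internal node $u_i(0,t)=u_1(1,t)$ for $2\le i\le N$ and $\sum_{2\le i\le N}c_iu_{i,x}(0,t)-c_1u_{1,x}(1,t)=-\alpha_1u_{1,t}(1,t)$, where $\alpha_1\in\mathbb R$. Functions are allowed to be complex valued. Space and operator. $$\mathcal H_0=\Big\{(u_i,v_i)_{i\in\mathcal I}\in\prod_{i\in\mathcal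 I}[H^1(0,1)\times L^2(0,1)]:\ u_i(0)=u_1(1)\text{ for }2\le i\le N,\ u_1(0)=0\Big\}.$$ $A_D\big((u_i,v_i)_{i\in\mathcal I}\big)=(v_i,c_i^2u_i'')_{i\in\mathcal I}$, with domain the set of $(u_i,v_i)_{i\in\mathcal I}\in\mathcal H_0$ with $u_i\in H^2(0,1)$, $v_i\in H^1(0,1)$ such that $u_1(0)=v_1(0)=0$; $c_iu_i'(1)=-v_i(1)$ for $2\le i\le N$; $\sum_{2\le i\le N}c_iu_i'(0)-c_1u_1'(1)=-\alpha_1v_1(1)$; and $(u_i(0),v_i(0))=(u_1(1),v_1(1))$ for $2\le i\le N$. For $\alpha_1\ne N$, $A_D$ generates a strongly continuous semigroup on $\mathcal H_0$, and solutions of $U_t=A_DU$, $U(0)=U_0\in\mathcal H_0$ are its trajectories. Conventions. The discrete spectrum $\sigma_d(A_D)$ is the set of (complex) eigenvalues of $A_D$. $\log_{-\pi/2}$ is the determination of the logarithm on $\mathbb C\setminus i\mathbb R^-$ with $\log_{-\pi/2}(z)=\log|z|$ for $z\in(0,+\infty)$ and $\log_{-\pi/2}(z)=\log|z|+i\pi$ for $z\in(-\infty,0)$. Finite-time stabilization in $\mathcal H_0$ means that the origin is stable and every solution reaches $0$ in finite time (and remains there). *)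

(* Defs.v *)
From mathcomp Require Import all_boot all_order all_algebra.
From mathcomp Require Import all_classical all_reals all_analysis.
From mathcomp Require Import complex.

Set Implicit Arguments.
Unset Strict Implicit.
Unset Printing Implicit Defensive.

Import Order.TTheory GRing.Theory Num.Theory.
Import numFieldNormedType.Exports.

Local Open Scope classical_set_scope.
Local Open Scope complex_scope.
Local Open Scope ring_scope.

(* Complex-valued functions on (0,1) are maps R -> R[i] of which only the
   restriction to ]0, 1[ matters. Elements of L^2(0,1) and H^1(0,1) are
   represented by such maps up to equality almost everywhere: no quotient is
   taken, and every notion below that is used on classes takes the same value
   on two measurable functions that are [aeq]. Measurability, continuity and
   integration of a complex-valued function are those of its real and
   imaginary parts. *)

Section Sobolev.
Context {R : realType}.
Implicit Types f g w : R -> R[i].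

Local Notation mu := (@lebesgue_measure R).
Local Notation I01 := (`]0%R, 1%R[%classic : set R).

Definition aeq f g : Prop := {ae mu, forall x, I01 x -> f x = g x}.

Definition cintegral f : R[i] :=
  (\int[mu]_(x in I01) complex.Re (f x))%R +i* (\int[mu]_(x in I01) complex.Im (f x))%R.

Definition L2 f : Prop :=
  [/\ measurable_fun I01 (fun x => complex.Re (f x)),
      measurable_fun I01 (fun x => complex.Im (f x)) &
      (\int[mu]_(x in I01) (Normc.normc (f x) ^+ 2)%:E < +oo)%E].

Definition L2sq f : R := (\int[mu]_(x in I01) (Normc.normc (f x) ^+ 2))%R.

(* C^1 functions with compact support in ]0, 1[; real-valued ones are enough,
   by linearity. *)
Definition test_function (phi : R -> R) : Prop :=
  [/\ forall x, derivable phi x 1,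
      continuous (phi^`())%classic &
      exists a b : R, [/\ 0 < a, a < b, b < 1 &
        forall x, ~ `[a, b]%classic x -> phi x = 0]].

Definition weak_derivative f g : Prop :=
  forall phi, test_function phi ->
    cintegral (fun x => f x * ((phi^`())%classic x)%:C) =
    - cintegral (fun x => g x * (phi x)%:C).

Definition H1 f : Prop := L2 f /\ exists g, L2 g /\ weak_derivative f g.

(* The derivative of f in H^1(0,1), unique up to [aeq] (junk value 0 when f is
   not in H^1(0,1)). *)
Definition wderiv f : R -> R[i] :=
  xget (fun=> 0) [set g | L2 g /\ weak_derivative f g].

Definition H2 f : Prop := H1 f /\ H1 (wderiv f).

(* The representative of f that is continuous on [0, 1], which exists for f in
   H^1(0,1) and whose values on [0, 1] are then unique; boundary values of
   elements of H^1(0,1) are those of this representative. *)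
Definition crep f : R -> R[i] :=
  xget (fun=> 0) [set w : R -> R[i] | [/\ {within `[0, 1], continuous (fun x : R => complex.Re (w x) : R)},
                             {within `[0, 1], continuous (fun x : R => complex.Im (w x) : R)} &
                             aeq f w]].

Definition trace f (x : R) : R[i] := crep f x.

End Sobolev.

(* The star has N = n.+2 >= 2 edges, numbered from 0: [ord0] is the edge from
   the root to the internal node, the other indices are the edges from the
   internal node to the other external nodes. A state U is (u_i, v_i)_i, with
   u_i = (U i).1 and v_i = (U i).2. *)
Definition state (R : realType) (n : nat) : Type :=
  'I_n.+2 -> (R -> R[i]) * (R -> R[i]).

Section Star.
Context {R : realType} {n : nat}.
Implicit Types U V F : state R n.

Definition eqH U V : Prop :=
  forall i, aeq (U i).1 (V i).1 /\ aeq (U i).2 (V i).2.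

Definition H0 U : Prop :=
  [/\ forall i, H1 (U i).1 /\ L2 (U i).2,
      forall i, i != ord0 -> trace (U i).1 0 = trace (U ord0).1 1 &
      trace (U ord0).1 0 = 0].

Definition normH U : R :=
  Num.sqrt (\sum_(i < n.+2)
    (L2sq (U i).1 + L2sq (wderiv (U i).1) + L2sq (U i).2)).

Definition domAD (c : 'I_n.+2 -> R) (alpha : R) U : Prop :=
  H0 U /\
  [/\ forall i, H2 (U i).1 /\ H1 (U i).2,
      trace (U ord0).1 0 = 0 /\ trace (U ord0).2 0 = 0,
      forall i, i != ord0 ->
        (c i)%:C * trace (wderiv (U i).1) 1 = - trace (U i).2 1,
      \sum_(i < n.+2 | i != ord0) (c i)%:C * trace (wderiv (U i).1) 0
        - (c ord0)%:C * trace (wderiv (U ord0).1) 1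
      = - (alpha%:C * trace (U ord0).2 1) &
      forall i, i != ord0 ->
        trace (U i).1 0 = trace (U ord0).1 1 /\
        trace (U i).2 0 = trace (U ord0).2 1].

Definition AD (c : 'I_n.+2 -> R) U : state R n :=
  fun i => ((U i).2, (fun x => (c i ^+ 2)%:C * wderiv (wderiv (U i).1) x)).

Definition sigma_d (c : 'I_n.+2 -> R) (alpha : R) : set R[i] :=
  [set lam | exists U, [/\ domAD c alpha U, ~ eqH U 0 &
                          eqH (AD c U) (lam *: U)]].

Definition C0_semigroup (S : R -> state R n -> state R n) : Prop :=
  [/\ forall t, 0 <= t ->
        [/\ forall U, H0 U -> H0 (S t U),
            forall U V, H0 U -> H0 V -> eqH U V -> eqH (S t U) (S t V),
            forall (a : R[i]) U V, H0 U -> H0 V ->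
              eqH (S t (a *: U + V)) (a *: S t U + S t V) &
            exists M : R, forall U, H0 U -> normH (S t U) <= M * normH U],
      forall U, H0 U -> eqH (S 0 U) U,
      forall s t U, 0 <= s -> 0 <= t -> H0 U ->
        eqH (S (s + t) U) (S s (S t U)) &
      forall U, H0 U -> normH (S h U - U) @[h --> (0 : R)^'+] --> (0 : R)].

Definition generator (dom : state R n -> Prop) (A : state R n -> state R n)
    (S : R -> state R n -> state R n) : Prop :=
  forall U F, H0 U -> H0 F ->
    (normH ((h^-1)%:C *: (S h U - U) - F) @[h --> (0 : R)^'+] --> (0 : R))
    <-> (dom U /\ eqH (A U) F).

(* The trajectories t |-> S t U, for U in H_0: stability of the origin, and
   every trajectory reaches 0 in finite time and remains there. *)
Definition finite_time_stable (S : R -> state R n -> state R n) : Prop :=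
  (forall eps : R, 0 < eps -> exists2 delta : R, 0 < delta &
     forall U, H0 U -> normH U < delta ->
       forall t, 0 <= t -> normH (S t U) < eps) /\
  (forall U, H0 U -> exists2 T : R, 0 <= T &
     forall t, T <= t -> eqH (S t U) 0).

End Star.

Section Logarithm.
Context {R : realType}.

(* The argument in ]- pi / 2, 3 pi / 2[, for z outside the half-line i R^-. *)
Definition arg_mhalfpi (z : R[i]) : R :=
  if 0 < complex.Re z then atan (complex.Im z / complex.Re z)
  else if complex.Re z < 0 then atan (complex.Im z / complex.Re z) + pi
  else pi / 2.

Definition log_mhalfpi (z : R[i]) : R[i] := ln (Normc.normc z) +i* arg_mhalfpi z.

Definition lambda (n : nat) (c : 'I_n.+2 -> R) (alpha : R) (k : int) : R[i] :=
  let N : R := n.+2%:R in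
  (c ord0 / 2)%:C * log_mhalfpi ((N - 2 - alpha) / (N - alpha))%:C
  + 'i%C * (c ord0 * k%:~R * pi)%:C.

End Logarithm.

(* Main.v *)
Require Import Defs.
From mathcomp Require Import all_boot all_order all_algebra.
From mathcomp Require Import all_classical all_reals all_analysis.
From mathcomp Require Import complex measurable_realfun ring lra.

(** On each edge, an eigenvector for lam is of the form (u_i, lam u_i) with
    c_i^2 u_i'' = lam^2 u_i; for lam <> 0, u_i is thus a combination of
    exp(lam x / c_i) and exp(- lam x / c_i). The transparent conditions discard
    the first exponential on the outgoing edges, the Dirichlet condition makes u
    a multiple of sinh(lam x / c_0) on the root edge, and continuity carries the
    value of this sinh at the node to all the other edges. What remains of the
    node condition is

      (N - alpha) exp(2 lam / c_0) = N - 2 - alpha,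

    see [eigenvalue_characteristic] and [characteristic_eigenvalue]; and lam = 0
    only allows the zero vector ([AD_kernel_trivial]). As an exponential does not
    vanish, the equation has no solution when alpha = N - 2; otherwise its
    solutions are the logarithms of a nonzero real number ([lambda_cexp]).

    Derivatives being weak and functions being known almost everywhere only,
    these computations rest on some theory of H^1(0,1), all of which comes from
    one fact, [weak_deriv_primitive]: a function that has a weak derivative is a
    primitive of it almost everywhere. Testing against a C^1 approximation of the
    indicator function of [a, b] gives it for all Lebesgue points a and b. It
    yields the uniqueness of weak derivatives, the existence of continuous
    representatives, hence the linearity of traces, and the fact that a function
    of zero weak derivative is constant. The latter solves the differential
    equation: u'' = mu^2 u factors into two first order equations, each of which
    is integrated after multiplication by an exponential ([ode_wave]).

    A semigroup with an eigenvector U does not stabilize in finite time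
    ([eigenvector_not_finite_time]): stability bounds the semigroup uniformly in
    time, and then the identity S h U = (1 + h lam) U + o(h), iterated along a fine
    subdivision of [0, T], bounds the norm of S T U from below by a positive
    multiple of that of U. *)

Set Implicit Arguments.
Unset Strict Implicit.
Unset Printing Implicit Defensive.

Import Order.TTheory GRing.Theory Num.Theory.
Import numFieldNormedType.Exports.

Local Open Scope classical_set_scope.
Local Open Scope complex_scope.
Local Open Scope ring_scope.

(** * Smooth steps *)

Section Tent.
Context {R : realType}.
Implicit Types s t x y : R.

Definition pos_part x : R := Num.max 0 x.

(** The C^1 primitive of the positive part. Finite differences of it give C^1
    cutoffs, which is all the smoothness that a test function requires. *)
Definition halfsq x : R := pos_part x ^+ 2 / 2.

Lemma pos_part_continuous : continuous pos_part.
Proof. by move=> x; apply: continuous_max; [exact: cst_continuous|exact: id]. Qed.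

Lemma is_derive_halfsq x : is_derive x 1 halfsq (pos_part x).
Proof.
rewrite /pos_part; have [x0|x0|<-] := ltgtP 0 x.
- apply: (@near_eq_is_derive _ _ _ (fun y : R => y ^+ 2 / 2)).
    near=> y; rewrite /halfsq /pos_part max_r//; near: y.
    by near do apply: ltW; exact: lt_nbhsr.
  apply: is_derive_eq; rewrite /GRing.scale /=; by field.
- apply: (@near_eq_is_derive _ _ _ (cst 0)).
    near=> y; rewrite /halfsq /pos_part max_l ?expr0n ?mul0r//; near: y.
    by near do apply: ltW; exact: lt_nbhsl.
- have cv : h^-1 *: (halfsq (h *: 1 + 0) - halfsq 0) @[h --> 0^'] --> (0:R).
    apply/cvgrPdist_le => e e0; near=> h.
    have h0 : h != 0 by near: h; exact: nbhs_dnbhs_neq.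
    rewrite sub0r normrN /halfsq /pos_part maxxx expr0n mul0r subr0.
    rewrite /GRing.scale /= mulr1 addr0 normrM normfV ler_pdivrMl ?normr_gt0//.
    have : `|h| <= e.
      near: h; apply: dnbhs0_le => //.
    have [hh|hh] := ltrP 0 h.
      rewrite (gtr0_norm hh) ger0_norm ?divr_ge0 ?sqr_ge0//; nra.
    by rewrite expr0n mul0r normr0 => he; rewrite mulr_ge0// ltW.
  split; first by apply/cvg_ex; exists 0.
  exact: cvg_lim cv.
Unshelve. all: by end_near. Qed.

(** Second differences of [pos_part] and [halfsq]: [hat] is the tent supported in
    [-1, 1], and [ramp] its primitive, a C^1 step from 0 to 1. *)
Definition hat s : R := pos_part (s + 1) - 2 * pos_part s + pos_part (s - 1).
Definition ramp s : R := halfsq (s + 1) - 2 * halfsq s + halfsq (s - 1).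

Lemma hat_continuous : continuous hat.
Proof.
move=> s; apply: cvgD; [apply: cvgB|].
- apply: (@continuous_comp _ _ _ (fun y => y + 1) pos_part).
    by apply: cvgD; [exact: cvg_id|exact: cvg_cst].
  exact: pos_part_continuous.
- by apply: cvgM; [exact: cvg_cst|exact: pos_part_continuous].
- apply: (@continuous_comp _ _ _ (fun y => y - 1) pos_part).
    by apply: cvgB; [exact: cvg_id|exact: cvg_cst].
  exact: pos_part_continuous.
Qed.

Lemma is_derive_ramp s : is_derive s 1 ramp (hat s).
Proof.
have d1 : is_derive s 1 (halfsq \o (fun y => y + 1)) (pos_part (s + 1)).
  apply: is_derive_eq.
    by apply: is_derive1_comp; exact: is_derive_halfsq.
  by rewrite addr0 mulr1.
have d2 : is_derive s 1 (halfsq \o (fun y => y - 1)) (pos_part (s - 1)).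
  apply: is_derive_eq.
    by apply: is_derive1_comp; exact: is_derive_halfsq.
  by rewrite subr0 mulr1.
have d0 := is_derive_halfsq s.
apply: is_derive_eq.
by rewrite /hat /GRing.scale /=; ring.
Qed.

Lemma hat_ge0 s : 0 <= hat s.
Proof. by rewrite /hat /pos_part /Order.max; do 3 case: ifP; lra. Qed.
Lemma hat_le1 s : hat s <= 1.
Proof. by rewrite /hat /pos_part /Order.max; do 3 case: ifP; lra. Qed.
Lemma hat_out s : 1 <= `|s| -> hat s = 0.
Proof.
by rewrite ler_normr /hat /pos_part /Order.max => /orP[]; do 3 case: ifP; lra.
Qed.
Lemma ramp_left s : s <= -1 -> ramp s = 0.
Proof. by rewrite /ramp /halfsq /pos_part /Order.max; do 3 case: ifP; nra. Qed.
Lemma ramp_right s : 1 <= s -> ramp s = 1.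
Proof. by rewrite /ramp /halfsq /pos_part /Order.max; do 3 case: ifP; nra. Qed.
Lemma ramp_ge0 s : 0 <= ramp s.
Proof. by rewrite /ramp /halfsq /pos_part /Order.max; do 3 case: ifP; nra. Qed.
Lemma ramp_le1 s : ramp s <= 1.
Proof. by rewrite /ramp /halfsq /pos_part /Order.max; do 3 case: ifP; nra. Qed.

End Tent.

(** * Integrable functions on the unit interval *)

Section UnitInterval.
Context {R : realType}.
Implicit Types f g r : R -> R.
Local Notation mu := (@lebesgue_measure R).
Local Notation I01 := (`]0%R, 1%R[%classic : set R).

Definition L1 f : Prop := mu.-integrable I01 (EFin \o f).

Lemma measurable_I01 : measurable (I01 : set (measurableTypeR R)).
Proof. exact: measurable_itv. Qed.
Local Hint Resolve measurable_I01 : core.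

Lemma mu_I01_lty : (mu I01 < +oo)%E.
Proof. by rewrite lebesgue_measure_itv/= lte_fin ltr01 ltry. Qed.

Lemma continuous_bounded01 r : continuous r -> [bounded r x | x in I01].
Proof.
move=> cr.
have : compact (r @` `[0, 1]).
  apply: continuous_compact; last exact: segment_compact.
  exact: continuous_subspaceT.
move=> /compact_bounded [M [Mr h]]; exists M; split => // x /h {}h y /= y01.
by apply: h; exists y => //; exact: subset_itv_oo_cc.
Qed.

Lemma continuous_measurable01 r : continuous r -> measurable_fun I01 r.
Proof. by move=> cr; apply: measurable_funTS; exact: continuous_measurable_fun. Qed.

Lemma L1_measurable f : L1 f -> measurable_fun I01 f.
Proof. by move=> /integrableP[/measurable_EFinP]. Qed.

Lemma L1_mulr f r : L1 f -> continuous r -> L1 (fun x => f x * r x).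
Proof.
move=> f1 cr; apply: (@integrableMl _ _ _ mu _ measurable_I01 (EFin \o f) r) => //.
  exact: continuous_measurable01.
exact: continuous_bounded01.
Qed.

Lemma L1_continuous r : continuous r -> L1 r.
Proof.
move=> cr; apply: measurable_bounded_integrable => //.
- exact: mu_I01_lty.
- exact: continuous_measurable01.
- exact: continuous_bounded01.
Qed.

Lemma L1D f g : L1 f -> L1 g -> L1 (fun x => f x + g x).
Proof. by move=> f1 g1; exact: (@integrableD _ _ _ mu _ _ (EFin \o f) (EFin \o g)). Qed.

Lemma L1Z (k : R) f : L1 f -> L1 (fun x => k * f x).
Proof. by move=> f1; exact: (@integrableZl _ _ _ mu _ _ k (EFin \o f)). Qed.

Lemma L1N f : L1 f -> L1 (fun x => - f x).
Proof. by move=> /(L1Z (-1)); congr L1; apply/funext => x; rewrite mulN1r. Qed.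

Lemma L1B f g : L1 f -> L1 g -> L1 (fun x => f x - g x).
Proof. by move=> f1 g1; apply: L1D => //; exact: L1N. Qed.

Lemma L1_norm f : L1 f -> L1 (fun x => `|f x|).
Proof. exact: integrable_norm. Qed.

(** The two endpoints are negligible. *)
Lemma Rintegral01_cc f : L1 f ->
  \int[mu]_(x in I01) f x = \int[mu]_(x in `[0, 1]) f x.
Proof.
move=> /integrableP[mf _]; rewrite /Rintegral integral_itv_bndo_bndc//.
congr fine; rewrite integral_itv_obnd_cbnd//.
exact/emeasurable_fun_itv_bndo_bndcP.
Qed.

Lemma L1_restrict f (A : set R) : measurable (A : set (measurableTypeR R)) ->
  L1 f -> L1 (f \_ A).
Proof.
move=> mA f1; rewrite /L1 -restrict_EFin; apply/integrable_restrict => //.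
apply: integrableS f1 => //; first exact: measurableI.
Qed.

Lemma restrictM_indic f (A : set R) : f \_ A = (fun x => f x * \1_A x).
Proof. by apply/funext => x; rewrite patchE indicE; case: ifP => _; rewrite ?mulr1 ?mulr0. Qed.

Lemma Rintegral01_FTC (F f : R -> R) : (forall x : R, is_derive x 1 F (f x)) ->
  continuous f -> \int[mu]_(x in I01) f x = F 1 - F 0.
Proof.
move=> dF cf; rewrite Rintegral01_cc; last exact: L1_continuous.
have cF : continuous F.
  by move=> x; apply/differentiable_continuous/derivable1_diffP; case: (dF x).
rewrite /Rintegral (@continuous_FTC2 _ f F) //=.
- exact: continuous_subspaceT.
- split.
  + by move=> x _; case: (dF x).
  + exact/cvg_at_right_filter/cF.
  + exact/cvg_at_left_filter/cF.
- by move=> x _; rewrite derive1E; case: (dF x).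
Qed.

End UnitInterval.
#[global] Hint Resolve measurable_I01 : core.

(** * Weakly differentiable functions are primitives *)

Section Bumps.
Context {R : realType}.
Implicit Types f g r phi : R -> R.
Local Notation mu := (@lebesgue_measure R).
Local Notation I01 := (`]0%R, 1%R[%classic : set R).

(** The real-valued counterpart of [weak_derivative]. Test functions being real,
    the real and the imaginary part of a weak derivative can be treated
    separately, by [weak_derivativeP]. *)
Definition weak_deriv f g : Prop := forall phi, test_function phi ->
  \int[mu]_(x in I01) (f x * (phi^`())%classic x) =
  - \int[mu]_(x in I01) (g x * phi x).

(** An approximate identity at [a]: total mass 1, supported in the ball of
    radius [e]. *)
Definition bump (a e : R) x : R := e^-1 * hat ((x - a) / e).

(** A C^1 approximation of the indicator function of [a, b]; its derivative is a
    bump at [a] minus a bump at [b]. *)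
Definition plateau (a b e : R) x : R := ramp ((x - a) / e) - ramp ((x - b) / e).

Lemma affine_derive (a e x : R) : is_derive x 1 (fun y : R => (y - a) / e) e^-1.
Proof.
have -> : (fun y : R => (y - a) / e) = (fun y => e^-1 *: (y - a)).
  by apply/funext => y; rewrite mulrC.
by apply: is_derive_eq; rewrite subr0 /GRing.scale /= mulr1.
Qed.

Lemma is_derive_ramp_affine (a e x : R) :
  is_derive x 1 (fun y : R => ramp ((y - a) / e)) (bump a e x).
Proof.
have h := @is_derive1_comp R ramp (fun y => (y - a) / e) x _ _
  (is_derive_ramp ((x - a) / e)) (affine_derive a e x).
by apply: (is_derive_eq h); rewrite /bump mulrC.
Qed.

Lemma bump_continuous (a e : R) : continuous (bump a e).
Proof.
move=> x; apply: cvgM; first exact: cvg_cst.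
apply: (@continuous_comp _ _ _ (fun y => (y - a) / e) hat).
  by apply/differentiable_continuous/derivable1_diffP; case: (affine_derive a e x).
exact: hat_continuous.
Qed.

Lemma is_derive_plateau (a b e x : R) :
  is_derive x 1 (plateau a b e) (bump a e x - bump b e x).
Proof.
by apply: is_deriveB; exact: is_derive_ramp_affine.
Qed.

Lemma test_function_plateau (a b e : R) :
  0 < e -> a < b -> 0 < a - e -> b + e < 1 -> test_function (plateau a b e).
Proof.
move=> e0 ab ae be; split.
- by move=> x; case: (is_derive_plateau a b e x).
- have -> : ((plateau a b e)^`())%classic = (fun x => bump a e x - bump b e x).
    by apply/funext => x; rewrite derive1E; case: (is_derive_plateau a b e x).
  by move=> x; apply: cvgB; exact: bump_continuous.
- exists (a - e), (b + e); split => //; first by lra.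
  move=> x; rewrite /= in_itv /= => /negP; rewrite negb_and -!ltNge => /orP[] xh.
    rewrite /plateau !ramp_left ?subr0// ler_pdivrMr//; lra.
  rewrite /plateau !ramp_right ?subrr// ler_pdivlMr//; lra.
Qed.

Lemma Rintegral_bump (a e : R) : 0 < e -> 0 < a - e -> a + e < 1 ->
  \int[mu]_(x in I01) bump a e x = 1.
Proof.
move=> e0 ae be.
rewrite (Rintegral01_FTC (is_derive_ramp_affine a e) (@bump_continuous a e)).
by rewrite ramp_right ?ramp_left ?subr0// ?ler_pdivrMr// ?ler_pdivlMr//; lra.
Qed.

Lemma bump_le (a e x : R) : 0 < e -> 0 <= bump a e x <= e^-1.
Proof.
move=> e0; rewrite mulr_ge0 ?invr_ge0 ?hat_ge0 ?(ltW e0)//=.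
by rewrite ler_piMr ?invr_ge0 ?hat_le1 ?(ltW e0).
Qed.

Lemma bump_out (a e x : R) : 0 < e -> ~ ball a e x -> bump a e x = 0.
Proof.
move=> e0 xB; rewrite /bump hat_out ?mulr0//.
rewrite normrM normfV (gtr0_norm e0) ler_pdivlMr// mul1r leNgt.
by apply/negP => h; apply: xB; rewrite /ball /= distrC.
Qed.

Lemma ball_sub01 (a e : R) : 0 < a - e -> a + e < 1 -> ball a e `<=` I01.
Proof.
move=> ae be x; rewrite ball_itv /= !in_itv /= => /andP[xa xb]; lra.
Qed.

(** Since the bump has mass 1, the difference is an average of f - f a; the bump
    being at most 1/e on a ball of measure 2e, it is bounded by twice the mean
    oscillation of f, which tends to 0 at a Lebesgue point. *)
Lemma bump_average f (a e : R) : L1 f -> 0 < e -> 0 < a - e -> a + e < 1 ->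
  `| \int[mu]_(x in I01) (f x * bump a e x) - f a | <=
  2 * fine (davg (f \_ I01) a e).
Proof.
move=> f1 e0 ae be.
have cb := @bump_continuous a e.
have mB : measurable (ball a e : set (measurableTypeR R)) by exact: measurable_ball.
have BI := ball_sub01 ae be.
have aI : I01 a by apply: BI; exact: ballxx.
have f2 : L1 (fun x => f x - f a) by apply: L1B => //; apply: L1_continuous; exact: cst_continuous.
have -> : \int[mu]_(x in I01) (f x * bump a e x) - f a =
    \int[mu]_(x in I01) ((f x - f a) * bump a e x).
  under [RHS]eq_Rintegral do rewrite mulrBl.
  rewrite RintegralB//; last 2 first.
    exact: L1_mulr.
    by apply: L1Z; exact: L1_continuous.
  by rewrite RintegralZl//= ?Rintegral_bump ?mulr1//; exact: L1_continuous.
apply: le_trans.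
  by apply: le_normr_Rintegral => //; exact: L1_mulr.
apply: (@le_trans _ _ (\int[mu]_(x in I01) ((fun x => e^-1 * `|f x - f a|) \_ (ball a e)) x)).
{ apply: le_Rintegral => //.
  - by apply: L1_norm; exact: L1_mulr.
  - by apply: L1_restrict => //; apply: L1Z; exact: L1_norm.
  - move=> x _; rewrite patchE; case: ifPn => xB.
      rewrite normrM mulrC ler_wpM2r//.
      by have /andP[b0 b1] := @bump_le a e x e0; rewrite ger0_norm.
    by rewrite bump_out ?mulr0 ?normr0//; move: xB; rewrite notin_setE. }
rewrite -Rintegral_mkcondl setIidl//.
have iB : mu.-integrable (ball a e) (EFin \o (fun x => `|f x - f a|)).
  by apply: (@integrableS _ _ _ mu I01 (ball a e)) => //; exact: L1_norm.
rewrite RintegralZl//.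
rewrite /davg /iavg lebesgue_measure_ball ?(ltW e0)// inver mulrn_eq0/= gt_eqF//.
rewrite fineM//; last first.
  under eq_integral.
    move=> y /set_mem yB; rewrite /= patchE mem_set; last exact: BI.
    rewrite patchE mem_set//. over.
  exact: integrable_fin_num iB.
rewrite [fine (_^-1)%:E]/=.
have -> : fine (\int[mu]_(y in ball a e) `|((center ((f \_ I01) a) \o f \_ I01) y)%:E|)%E
   = \int[mu]_(x in ball a e) `|f x - f a|.
  congr fine; apply: eq_integral => y /set_mem yB.
  by rewrite /= patchE mem_set; [rewrite patchE mem_set//|exact: BI].
rewrite mulrA ler_wpM2r//; first by apply: Rintegral_ge0.
by rewrite -[e *+ 2]mulr_natl invfM mulrA divff// mul1r.
Qed.

End Bumps.

Section PlateauApproximation.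
Context {R : realType}.
Implicit Types f g r phi : R -> R.
Local Notation mu := (@lebesgue_measure R).
Local Notation I01 := (`]0%R, 1%R[%classic : set R).

Lemma L1_cc f : L1 f -> mu.-integrable `[0, 1] (EFin \o f).
Proof.
move=> /integrableP[mf foo]; apply/integrableP.
have mf1 : measurable_fun (`]0%R, 1%R]%classic : set R) (EFin \o f) by exact/emeasurable_fun_itv_bndo_bndcP.
have mf2 : measurable_fun (`[0%R, 1%R]%classic : set R) (EFin \o f) by exact/emeasurable_fun_itv_obnd_cbndP.
split => //.
rewrite -integral_itv_obnd_cbnd; last exact: measurableT_comp.
by rewrite -integral_itv_bndo_bndc//; exact: measurableT_comp.
Qed.

(** The plateau and the indicator function of [a, b] agree outside the balls of
    radius e around a and b, and there the integral of |g| is small by absolute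
    continuity of the integral. *)
Lemma plateau_approx g (a b eps : R) : L1 g -> 0 < a -> a < b -> b < 1 -> 0 < eps ->
  \forall e \near 0^'+,
  `| \int[mu]_(x in I01) (g x * plateau a b e x) - \int[mu]_(x in `[a, b]) g x | <= eps.
Proof.
move=> g1 a0 ab b1 eps0.
have ig : mu.-integrable setT (EFin \o (g \_ I01)).
  by rewrite -restrict_EFin; apply/integrable_restrict => //; rewrite setTI.
have e20 : 0 < eps / 2 by lra.
have [d [d0 hd]] := integral_normr_continuous ig e20.
near=> e.
have e0 : 0 < e by near: e; exact: nbhs_right_gt.
(* Two balls of measure 2e must have total measure less than d. *)
have ed : e < d / 4 by near: e; apply: nbhs_right_lt; lra.
have ea : e < a by near: e; exact: nbhs_right_lt.
have eb : e < 1 - b by near: e; apply: nbhs_right_lt; lra.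
have mB c : measurable (ball c e : set (measurableTypeR R)) by exact: measurable_ball.
pose A : set R := ball a e `|` ball b e.
have mA : measurable (A : set (measurableTypeR R)) by exact: measurableU.
have AI : A `<=` I01 by move=> x [|]; apply: ball_sub01; lra.
have muA : (mu A < d%:E)%E.
  apply: le_lt_trans; first exact: (measureU2 mu (mB a) (mB b)).
  have muB c : mu (ball c e) = (e *+ 2)%:E by exact: lebesgue_measure_ball (ltW e0).
  apply: (@le_lt_trans _ _ ((e *+ 2)%:E + (e *+ 2)%:E)%E).
    by apply: leeD; rewrite le_eqVlt; apply/orP; left; apply/eqP; exact: muB.
  by rewrite -EFinD lte_fin; lra.
have cp : continuous (plateau a b e).
  move=> x; apply/differentiable_continuous/derivable1_diffP.
  by case: (is_derive_plateau a b e x).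
have mab : measurable (`[a, b]%classic : set (measurableTypeR R)) by exact: measurable_itv.
have abI : `[a, b] `<=` I01.
  by move=> x; rewrite /= !in_itv /= => /andP[? ?]; lra.
rewrite -[X in \int[mu]_(x in X) g x](setIidl abI) Rintegral_mkcondl -RintegralB//; last 2 first.
  exact: L1_mulr.
  exact: L1_restrict.
have L1d : L1 (fun x => g x * plateau a b e x - (g \_ `[a, b]) x).
  by apply: L1B; [exact: L1_mulr|exact: L1_restrict].
apply: le_trans.
  by apply: le_normr_Rintegral.
apply: (@le_trans _ _ (\int[mu]_(x in I01) ((fun x => 2 * `|g x|) \_ A) x)).
{ apply: le_Rintegral => //.
  - exact: L1_norm.
  - by apply: L1_restrict => //; apply: L1Z; exact: L1_norm.
  - move=> x _.
    have p1 := ramp_ge0 ((x - a) / e); have p2 := ramp_le1 ((x - a) / e).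
    have p3 := ramp_ge0 ((x - b) / e); have p4 := ramp_le1 ((x - b) / e).
    rewrite (restrictM_indic g `[a, b]) -mulrBr normrM mulrC patchE indicE.
    case: ifPn => xA.
      rewrite ler_wpM2r// ler_norml /plateau.
      by case: (_ \in _) => /=; lra.
    have {}xA : ~ A x by rewrite notin_setE in xA.
    have xa : x <= a - e \/ a + e <= x.
      case: (lerP x (a - e)) => [|h1]; [by left|right].
      by rewrite leNgt; apply/negP => h2; apply: xA; left; rewrite ball_itv /= in_itv /= h1.
    have xb : x <= b - e \/ b + e <= x.
      case: (lerP x (b - e)) => [|h1]; [by left|right].
      by rewrite leNgt; apply/negP => h2; apply: xA; right; rewrite ball_itv /= in_itv /= h1.
    rewrite /plateau; case: xa => xa.
      rewrite !ramp_left ?ler_pdivrMr//; try lra.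
      rewrite memNset; last by rewrite /= in_itv /= => /andP[? ?]; lra.
      by rewrite !subr0 normr0 mul0r.
    rewrite (@ramp_right _ ((x - a) / e)) ?ler_pdivlMr//; try lra.
    case: xb => xb.
      rewrite ramp_left ?ler_pdivrMr//; try lra.
      rewrite mem_set; last by rewrite /= in_itv /=; apply/andP; split; lra.
      by rewrite subr0 subrr normr0 mul0r.
    rewrite ramp_right ?ler_pdivlMr//; try lra.
    rewrite memNset; last by rewrite /= in_itv /= => /andP[? ?]; lra.
    by rewrite subrr subr0 normr0 mul0r. }
rewrite -Rintegral_mkcondl setIidl// RintegralZl//; last first.
  by apply: (@integrableS _ _ _ mu I01 A) => //; exact: L1_norm.
have := hd A mA muA.
under eq_Rintegral do rewrite patchE.
under eq_Rintegral => x xA.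
  rewrite (_ : x \in I01); last by move: xA; rewrite !inE; exact: AI.
  over.
by lra.
Unshelve. all: by end_near. Qed.

End PlateauApproximation.

Section PrimitiveOfWeakDerivative.
Context {R : realType}.
Implicit Types f g r phi : R -> R.
Local Notation mu := (@lebesgue_measure R).
Local Notation I01 := (`]0%R, 1%R[%classic : set R).

Lemma bump_approx f (a eps : R) : L1 f -> I01 a -> lebesgue_pt (f \_ I01) a -> 0 < eps ->
  \forall e \near 0^'+, `| \int[mu]_(x in I01) (f x * bump a e x) - f a | <= eps.
Proof.
move=> f1; rewrite /= in_itv /= => /andP[a0 a1] la eps0.
have e20 : 0 < eps / 2 by lra.
have h : \forall e \near 0^'+, (davg (f \_ I01) a e < (eps / 2)%:E)%E.
  by apply: (la [set y | (y < (eps / 2)%:E)%E]); apply: open_ereal_lt'; rewrite lte_fin.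
near=> e.
have e0 : 0 < e by near: e; exact: nbhs_right_gt.
have ea : e < a by near: e; exact: nbhs_right_lt.
have eb : e < 1 - a by near: e; apply: nbhs_right_lt; lra.
apply: le_trans; first by apply: bump_average => //; lra.
have : (davg (f \_ I01) a e < (eps / 2)%:E)%E by near: e.
have := davg_ge0 (f \_ I01) a e.
case: (davg _ _ _) => [r| |]//=; rewrite !(lee_fin, lte_fin); lra.
Unshelve. all: by end_near. Qed.

(** Test the weak derivative against the plateau over [a, b] and let its slopes
    steepen: the integral of f against the two bumps tends to f a - f b, that of
    g against the plateau to the integral of g over [a, b]. *)
Lemma weak_deriv_lebesgue f g (a b : R) : L1 f -> L1 g -> weak_deriv f g ->
  I01 a -> I01 b -> a < b ->
  lebesgue_pt (f \_ I01) a -> lebesgue_pt (f \_ I01) b ->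
  f b - f a = \int[mu]_(x in `[a, b]) g x.
Proof.
move=> f1 g1 fg Ia Ib ab la lb.
move: (Ia) (Ib); rewrite /= !in_itv /= => /andP[a0 a1] /andP[b0 b1].
apply/eqP; rewrite -subr_eq0 -normr_le0; apply/ler_addgt0Pr => eps eps0.
have e30 : 0 < eps / 3 by lra.
have [e [[[[[e0 ea] eb] h1] h2] h3]] : exists e, ((((0 < e /\ e < a) /\ e < 1 - b) /\
  `| \int[mu]_(x in I01) (f x * bump a e x) - f a | <= eps / 3) /\
  `| \int[mu]_(x in I01) (f x * bump b e x) - f b | <= eps / 3) /\
  `| \int[mu]_(x in I01) (g x * plateau a b e x) - \int[mu]_(x in `[a, b]) g x | <= eps / 3.
{ near (0:R)^'+ => e; exists e; do ! split.
  - by near: e; exact: nbhs_right_gt.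
  - by near: e; exact: nbhs_right_lt.
  - by near: e; apply: nbhs_right_lt; lra.
  - by near: e; exact: bump_approx.
  - by near: e; exact: bump_approx.
  - by near: e; exact: plateau_approx. }
have tp : test_function (plateau a b e) by apply: test_function_plateau => //; lra.
have := fg _ tp.
under eq_Rintegral do rewrite derive1E (@derive_val _ _ _ _ _ _ _ (is_derive_plateau a b e _)) mulrBr.
rewrite RintegralB//; last 2 first.
  by apply: L1_mulr => //; exact: bump_continuous.
  by apply: L1_mulr => //; exact: bump_continuous.
move: h1 h2 h3; rewrite !ler_norml.
set X1 := \int[mu]_(x in I01) _; set X2 := \int[mu]_(x in I01) _.
set X3 := \int[mu]_(x in I01) _; set X4 := \int[mu]_(x in _) _.
by lra.
Unshelve. all: by end_near. Qed.

Lemma param_integralB g (x y : R) : L1 g -> 0 <= x -> x <= y -> y <= 1 ->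
  parameterized_integral mu 0 y g - parameterized_integral mu 0 x g =
  \int[mu]_(t in `[x, y]) g t.
Proof.
move=> g1 x0 xy y1.
have iy : mu.-integrable `[0, y] (EFin \o g).
  by apply: integrableS (L1_cc g1) => //; apply: subset_itvl; rewrite bnd_simp.
rewrite /parameterized_integral Rintegral_itvB//.
rewrite Rintegral_itv_obnd_cbnd//.
apply: integrableS iy => //.
by apply: subset_itvr; rewrite bnd_simp.
Qed.

Lemma lebesgue_pt_ae f : L1 f -> {ae mu, forall x, lebesgue_pt (f \_ I01) x}.
Proof.
by move=> f1; apply: lebesgue_differentiation; exact: integrable_locally_restrict.
Qed.

(** A nonempty open interval has positive measure. This turns almost everywhere
    statements into statements on dense sets, where continuity applies. *)
Lemma ae_meets_itv (P : R -> Prop) (a b : R) : {ae mu, forall x, P x} -> a < b ->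
  exists2 x, a < x < b & P x.
Proof.
move=> aeP ab; apply: contrapT => h.
have : mu.-negligible (`]a, b[%classic : set (measurableTypeR R)).
  apply: negligibleS aeP => x /=; rewrite in_itv /= => xab Px.
  by apply: h; exists x.
move/negligibleP => /(_ (measurable_itv _)).
have : lebesgue_measure (`]a, b[%classic : set R) = (b - a)%:E.
  by rewrite lebesgue_measure_itv /= lte_fin ab.
by move=> /[swap] -> /eqP; rewrite eqe lt_eqF// subr_gt0.
Qed.

Lemma ae_mono (P Q : R -> Prop) : {ae mu, forall x, P x} ->
  (forall x, P x -> Q x) -> {ae mu, forall x, Q x}.
Proof.
by move=> aeP PQ; move: aeP; apply: filterS; first exact: (ae_filter_ringOfSetsType mu).
Qed.

Lemma ae_mono2 (P Q S : R -> Prop) : {ae mu, forall x, P x} ->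
  {ae mu, forall x, Q x} ->
  (forall x, P x -> Q x -> S x) -> {ae mu, forall x, S x}.
Proof.
move=> aeP aeQ PQ; move: aeP aeQ.
by apply: filterS2; first exact: (ae_filter_ringOfSetsType mu).
Qed.

(** Almost every point is a Lebesgue point: fix one of them as base point and
    apply [weak_deriv_lebesgue] between it and any other one. *)
Theorem weak_deriv_primitive f g : L1 f -> L1 g -> weak_deriv f g ->
  exists C : R, {ae mu, forall x, I01 x -> f x = C + parameterized_integral mu 0 x g}.
Proof.
move=> f1 g1 fg.
have lf := lebesgue_pt_ae f1.
have [x0 x01 lx0] := ae_meets_itv lf ltr01.
exists (f x0 - parameterized_integral mu 0 x0 g).
apply: (ae_mono lf) => x lx Ix.
move: (Ix) x01; rewrite /= in_itv /= => /andP[xg0 xl1] /andP[x0g0 x0l1].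
have I0 : I01 x0 by rewrite /= in_itv /= x0g0.
case: (ltgtP x x0) => [h|h|->]; last by rewrite addrNK.
- have := weak_deriv_lebesgue f1 g1 fg Ix I0 h lx lx0.
  rewrite -param_integralB//; try exact: ltW.
  by move=> e; rewrite -[f x0](subrK (f x)) e; ring.
- have := weak_deriv_lebesgue f1 g1 fg I0 Ix h lx0 lx.
  rewrite -param_integralB//; try exact: ltW.
  by move=> e; rewrite -[f x](subrK (f x0)) e; ring.
Qed.

End PrimitiveOfWeakDerivative.

(** * Calculus of weak derivatives *)

Section WeakCalculus.
Context {R : realType}.
Implicit Types f g r phi : R -> R.
Local Notation mu := (@lebesgue_measure R).
Local Notation I01 := (`]0%R, 1%R[%classic : set R).

Lemma test_is_derive phi (x : R) : test_function phi -> is_derive x 1 phi (phi^`()%classic x).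
Proof.
by move=> [d _ _]; split; [exact: d|rewrite derive1E].
Qed.

Lemma is_derive_continuous (F f : R -> R) :
  (forall x : R, is_derive x 1 F (f x)) -> continuous F.
Proof.
by move=> dF x; apply/differentiable_continuous/derivable1_diffP; case: (dF x).
Qed.

Lemma test_continuous phi : test_function phi -> continuous phi.
Proof.
by move=> tp; apply: (@is_derive_continuous _ phi^`()%classic) => x; exact: test_is_derive.
Qed.

Lemma test_function_mul phi r r' : test_function phi ->
  (forall x : R, is_derive x 1 r (r' x)) -> continuous r' ->
  test_function (fun x => phi x * r x) /\
  ((fun x => phi x * r x)^`()%classic = fun x => phi^`()%classic x * r x + phi x * r' x).
Proof.
move=> tp dr cr'.
have cr := is_derive_continuous dr.
have cp := test_continuous tp.
have d (x : R) : is_derive x 1 (fun x => phi x * r x) (phi^`()%classic x * r x + phi x * r' x).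
  have dp := test_is_derive x tp.
  apply: is_derive_eq; rewrite /GRing.scale /=; ring.
have e : (fun x => phi x * r x)^`()%classic = fun x => phi^`()%classic x * r x + phi x * r' x.
  by apply/funext => x; rewrite derive1E; case: (d x).
split => //; case: tp => [_ cp' [a [b [a0 ab b1 h]]]]; split.
- by move=> x; case: (d x).
- by rewrite e => x; apply: cvgD; apply: cvgM; [exact: cp'|exact: cr|exact: cp|exact: cr'].
- by exists a, b; split => // x /h ->; rewrite mul0r.
Qed.

Lemma test_ends phi : test_function phi -> phi 0 = 0 /\ phi 1 = 0.
Proof.
move=> [_ _ [a [b [a0 ab b1 h]]]].
by split; apply: h; rewrite /= in_itv /= => /andP[? ?]; lra.
Qed.

Lemma weak_deriv_C1 (F f : R -> R) : (forall x : R, is_derive x 1 F (f x)) ->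
  continuous f -> weak_deriv F f.
Proof.
move=> dF cf phi tp.
have cF := is_derive_continuous dF.
have cp := test_continuous tp.
have d (x : R) : is_derive x 1 (fun x => F x * phi x) (F x * phi^`()%classic x + f x * phi x).
  have dp := test_is_derive x tp.
  apply: is_derive_eq; rewrite /GRing.scale /=; ring.
have cp' : continuous phi^`()%classic by case: tp.
have [p0 p1] := test_ends tp.
have c1 : continuous (fun x => F x * phi^`()%classic x) by move=> x; apply: cvgM; [exact: cF|exact: cp'].
have c2 : continuous (fun x => f x * phi x) by move=> x; apply: cvgM; [exact: cf|exact: cp].
have := @Rintegral01_FTC _ _ _ d.
rewrite p0 p1 !mulr0 subrr RintegralD//; try exact: L1_continuous.
by move=> h; apply/eqP; rewrite -addr_eq0; apply/eqP/h => x; apply: cvgD; [exact: c1|exact: c2].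
Qed.

(** The product of a test function with a C^1 function is again a test function,
    so the factor [r] can be moved onto it. *)
Lemma weak_derivM f g r r' : L1 f -> L1 g -> weak_deriv f g ->
  (forall x : R, is_derive x 1 r (r' x)) -> continuous r' ->
  weak_deriv (fun x => f x * r x) (fun x => g x * r x + f x * r' x).
Proof.
move=> f1 g1 fg dr cr' phi tp.
have cr := is_derive_continuous dr.
have cp := test_continuous tp.
have cp' : continuous phi^`()%classic by case: tp.
have [tpr epr] := test_function_mul tp dr cr'.
have L1p h k : L1 h -> continuous k -> L1 (fun x => h x * k x * phi x).
  by move=> h1 ck; do 2 apply: L1_mulr => //.
have := fg _ tpr; rewrite epr.
rewrite (_ : \int[mu]_(x in I01) (f x * (_ + _)) =
    \int[mu]_(x in I01) (f x * r x * phi^`()%classic x) +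
    \int[mu]_(x in I01) (f x * r' x * phi x)); last first.
  rewrite -RintegralD//; last 2 first.
    by do 2 apply: L1_mulr => //.
    exact: L1p.
  by apply: eq_Rintegral => x _; ring.
rewrite (_ : \int[mu]_(x in I01) ((_ + _) * phi x) =
    \int[mu]_(x in I01) (g x * (phi x * r x)) +
    \int[mu]_(x in I01) (f x * r' x * phi x)); last first.
  rewrite -RintegralD//; last 2 first.
    by apply: L1_mulr => // x; apply: cvgM; [exact: cp|exact: cr].
    exact: L1p.
  by apply: eq_Rintegral => x _; ring.
by move=> h; rewrite opprD -h addrK.
Qed.

Lemma weak_derivD f1 f2 g1 g2 : L1 f1 -> L1 f2 -> L1 g1 -> L1 g2 ->
  weak_deriv f1 g1 -> weak_deriv f2 g2 ->
  weak_deriv (fun x => f1 x + f2 x) (fun x => g1 x + g2 x).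
Proof.
move=> f11 f21 g11 g21 fg1 fg2 phi tp.
have cp := test_continuous tp.
have cp' : continuous phi^`()%classic by case: tp.
under eq_Rintegral do rewrite mulrDl.
under [in RHS]eq_Rintegral do rewrite mulrDl.
by rewrite !RintegralD ?fg1 ?fg2 ?opprD//; apply: L1_mulr.
Qed.

Lemma weak_derivZ (k : R) f g : L1 f -> L1 g -> weak_deriv f g ->
  weak_deriv (fun x => k * f x) (fun x => k * g x).
Proof.
move=> f1 g1 fg phi tp.
have cp := test_continuous tp.
have cp' : continuous phi^`()%classic by case: tp.
under eq_Rintegral do rewrite -mulrA.
under [in RHS]eq_Rintegral do rewrite -mulrA.
by rewrite !RintegralZl ?fg ?mulrN//; apply: L1_mulr.
Qed.

(** At a point where h does not vanish, it does not vanish on a neighbourhood in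
    [0, 1] either; even at the endpoints, that neighbourhood contains a nonempty
    open interval, so it has positive measure. *)
Lemma within_ae_eq0 (h : R -> R) : {within `[0, 1], continuous h} ->
  {ae mu, forall x, I01 x -> h x = 0} -> forall x, 0 <= x <= 1 -> h x = 0.
Proof.
move=> ch ae0 x /andP[x0 x1]; apply: contrapT => /eqP hx0.
have Ix : (`[0, 1]%classic : set R) x by rewrite /= in_itv /= x0.
have /subspace_continuousP/(_ x Ix)/cvgrPdist_lt := ch.
have hx : 0 < `|h x| by rewrite normr_gt0.
move=> /(_ _ hx) [r /= r0 hr].
have ab : Num.max 0 (x - r) < Num.min 1 (x + r).
  by rewrite gt_max !lt_min; apply/andP; split; apply/andP; split; lra.
have [y] := ae_meets_itv ae0 ab.
rewrite gt_max lt_min => /andP[/andP[y0 yr] /andP[y1 yr']] hy.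
have Iy : I01 y by rewrite /= in_itv /= y0 y1.
have : `|h x - h y| < `|h x|.
  apply: hr; last by rewrite /= in_itv /=; apply/andP; split; lra.
  by rewrite /= ltr_norml; apply/andP; split; lra.
by rewrite (hy Iy) subr0 ltxx.
Qed.

(** The difference of the two derivatives is a weak derivative of 0, so its
    primitive is constant; differentiate that primitive at Lebesgue points. *)
Lemma weak_deriv_unique f g1 g2 : L1 g1 -> L1 g2 ->
  weak_deriv f g1 -> weak_deriv f g2 -> {ae mu, forall x, I01 x -> g1 x = g2 x}.
Proof.
move=> i1 i2 w1 w2.
pose g := (fun x => g1 x - g2 x) \_ I01.
have ig : L1 g by apply: L1_restrict => //; exact: L1B.
have wg : weak_deriv (fun=> 0) g.
  move=> phi tp; have cp := test_continuous tp.
  under eq_Rintegral do rewrite mul0r.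
  under [in RHS]eq_Rintegral => x xI do rewrite /g patchE xI mulrBl.
  rewrite RintegralB ?Rintegral_cst// ?mul0r; try exact: L1_mulr.
  have := w1 _ tp; rewrite (w2 _ tp) => /oppr_inj ->.
  by rewrite subrr oppr0.
have i0 : L1 (fun=> 0 : R) by apply: L1_continuous; exact: cst_continuous.
have [C hC] := weak_deriv_primitive i0 ig wg.
have iT : mu.-integrable `[0, 1] (EFin \o g) by exact: L1_cc.
have hP : forall x, 0 <= x <= 1 -> C + parameterized_integral mu 0 x g = 0.
  apply: within_ae_eq0.
    apply/subspace_continuousP => x x01; apply: cvgD; first exact: cvg_cst.
    by move: x x01; apply/subspace_continuousP; exact: parameterized_integral_continuous.
  by apply: (ae_mono hC) => x + Ix => /(_ Ix).
apply: (ae_mono (lebesgue_pt_ae ig)) => x lx Ix.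
have {lx} lx : lebesgue_pt g x.
  suff -> : g = g \_ I01 by [].
  by apply/funext => y; rewrite /g !patchE; case: ifP => // ->.
move: (Ix); rewrite /= in_itv /= => /andP[x0 x1].
have [|_] := FTC1_lebesgue_pt x1 iT _ lx; first by rewrite -?lte_fin ?bnd_simp /=.
rewrite /g patchE mem_set// => e.
apply/eqP; rewrite -subr_eq0 -e; apply/eqP.
transitivity ((cst (- C) : R -> R)^`()%classic x); last by rewrite derive1_cst.
rewrite !derive1E; apply: near_eq_derive.
near=> y; apply/eqP; rewrite -addr_eq0 addrC /=; apply/eqP; apply: hP.
by apply/andP; split; apply: ltW; near: y; [exact: lt_nbhsr|exact: lt_nbhsl].
Unshelve. all: by end_near. Qed.

End WeakCalculus.

(** * Weak derivatives of complex-valued functions *)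

Section ComplexSobolev.
Context {R : realType}.
Implicit Types f g w : R -> R[i].
Implicit Types (a z : R[i]).
Local Notation mu := (@lebesgue_measure R).
Local Notation I01 := (`]0%R, 1%R[%classic : set R).
Local Notation Re := complex.Re.
Local Notation Im := complex.Im.

Lemma ReM z1 z2 : Re (z1 * z2) = Re z1 * Re z2 - Im z1 * Im z2.
Proof. by case: z1; case: z2. Qed.
Lemma ImM z1 z2 : Im (z1 * z2) = Re z1 * Im z2 + Im z1 * Re z2.
Proof. by case: z1; case: z2. Qed.
Lemma ReD z1 z2 : Re (z1 + z2) = Re z1 + Re z2.
Proof. by case: z1; case: z2. Qed.
Lemma ImD z1 z2 : Im (z1 + z2) = Im z1 + Im z2.
Proof. by case: z1; case: z2. Qed.
Lemma complex_ext z1 z2 : Re z1 = Re z2 -> Im z1 = Im z2 -> z1 = z2.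
Proof. by case: z1 => a b; case: z2 => c d /= -> ->. Qed.

Lemma normc_sqr z : Normc.normc z ^+ 2 = Re z ^+ 2 + Im z ^+ 2.
Proof. by case: z => a b; rewrite /= sqr_sqrtr// addr_ge0 ?sqr_ge0. Qed.

(** Weak derivatives only involve integrals against bounded functions, so
    integrability of both components is the natural assumption for them; elements
    of L^2(0,1) satisfy it. *)
Definition cL1 f : Prop := L1 (fun x => Re (f x)) /\ L1 (fun x => Im (f x)).

Definition ccontinuous f : Prop :=
  continuous (fun x => Re (f x) : R) /\ continuous (fun x => Im (f x) : R).

Definition is_cderive f g : Prop :=
  (forall x : R, is_derive x 1 (fun x => Re (f x) : R) (Re (g x) : R)) /\
  (forall x : R, is_derive x 1 (fun x => Im (f x) : R) (Im (g x) : R)).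

Lemma weak_derivativeP f g : weak_derivative f g <->
  weak_deriv (fun x => Re (f x)) (fun x => Re (g x)) /\
  weak_deriv (fun x => Im (f x)) (fun x => Im (g x)).
Proof.
have E h (k : R -> R) : cintegral (fun x => h x * (k x)%:C) =
    \int[mu]_(x in I01) (Re (h x) * k x) +i* \int[mu]_(x in I01) (Im (h x) * k x).
  by rewrite /cintegral; congr Complex; apply: eq_Rintegral => x _; rewrite ?ReM ?ImM /= mulr0 ?subr0 ?add0r.
rewrite /weak_derivative; split.
  move=> h; split => phi /h; rewrite !E => /eqP; rewrite eq_complex /= => /andP[/eqP h1 /eqP h2] //.
by move=> [h1 h2] phi tp; rewrite !E (h1 _ tp) (h2 _ tp).
Qed.

Lemma cL1_lin a f g : cL1 f -> cL1 g -> cL1 (fun x => a * f x + g x).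
Proof.
move=> [f1 f2] [g1 g2]; split.
  under eq_fun do rewrite ReD ReM.
  by apply: L1D => //; apply: L1B; exact: L1Z.
under eq_fun do rewrite ImD ImM.
by apply: L1D => //; apply: L1D; exact: L1Z.
Qed.

Lemma cL1_mul f g : cL1 f -> ccontinuous g -> cL1 (fun x => f x * g x).
Proof.
move=> [f1 f2] [g1 g2]; split.
  under eq_fun do rewrite ReM.
  by apply: L1B; exact: L1_mulr.
under eq_fun do rewrite ImM.
by apply: L1D; exact: L1_mulr.
Qed.

Lemma weak_derivative_lin a f f' g g' : cL1 f -> cL1 f' -> cL1 g -> cL1 g' ->
  weak_derivative f f' -> weak_derivative g g' ->
  weak_derivative (fun x => a * f x + g x) (fun x => a * f' x + g' x).
Proof.
move=> [f1 f2] [f'1 f'2] [g1 g2] [g'1 g'2].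
move=> /weak_derivativeP[wf1 wf2] /weak_derivativeP[wg1 wg2].
have Zk (k : R) := weak_derivZ k.
apply/weak_derivativeP; split.
  have -> : (fun x => Re (a * f x + g x)) = (fun x => Re a * Re (f x) + (- Im a) * Im (f x) + Re (g x)).
    by apply/funext => x; rewrite ReD ReM mulNr.
  have -> : (fun x => Re (a * f' x + g' x)) = (fun x => Re a * Re (f' x) + (- Im a) * Im (f' x) + Re (g' x)).
    by apply/funext => x; rewrite ReD ReM mulNr.
  by do 2! [apply: weak_derivD => //; try by [exact: L1Z|exact: Zk|apply: L1D; exact: L1Z]].
have -> : (fun x => Im (a * f x + g x)) = (fun x => Re a * Im (f x) + Im a * Re (f x) + Im (g x)).
  by apply/funext => x; rewrite ImD ImM.
have -> : (fun x => Im (a * f' x + g' x)) = (fun x => Re a * Im (f' x) + Im a * Re (f' x) + Im (g' x)).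
  by apply/funext => x; rewrite ImD ImM.
by do 2! [apply: weak_derivD => //; try by [exact: L1Z|exact: Zk|apply: L1D; exact: L1Z]].
Qed.

Lemma is_cderive_continuous f g : is_cderive f g -> ccontinuous f.
Proof. by move=> [f1 f2]; split; [exact: (is_derive_continuous f1)|exact: (is_derive_continuous f2)]. Qed.

Lemma weak_derivativeM f f' g g' : cL1 f -> cL1 f' -> weak_derivative f f' ->
  is_cderive g g' -> ccontinuous g' ->
  weak_derivative (fun x => f x * g x) (fun x => f' x * g x + f x * g' x).
Proof.
move=> [f1 f2] [f'1 f'2] /weak_derivativeP[wf1 wf2] [dg1 dg2] [cg1 cg2].
have [c1 c2] := is_cderive_continuous (conj dg1 dg2).
have L1M (h k h' k' : R -> R) : L1 h -> L1 k -> continuous h' -> continuous k' ->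
    L1 (fun x => h x * h' x + k x * k' x).
  by move=> ? ? ? ?; apply: L1D; exact: L1_mulr.
apply/weak_derivativeP; split.
- have := weak_derivD (L1_mulr f1 c1) (L1Z (-1) (L1_mulr f2 c2))
    (L1M _ _ _ _ f'1 f1 c1 cg1) (L1Z (-1) (L1M _ _ _ _ f'2 f2 c2 cg2))
    (weak_derivM f1 f'1 wf1 dg1 cg1)
    (weak_derivZ (-1) (L1_mulr f2 c2) (L1M _ _ _ _ f'2 f2 c2 cg2) (weak_derivM f2 f'2 wf2 dg2 cg2)).
  by congr weak_deriv; apply/funext => x; rewrite ?(ReD, ReM); ring.
- have := weak_derivD (L1_mulr f1 c2) (L1_mulr f2 c1)
    (L1M _ _ _ _ f'1 f1 c2 cg2) (L1M _ _ _ _ f'2 f2 c1 cg1)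
    (weak_derivM f1 f'1 wf1 dg2 cg2) (weak_derivM f2 f'2 wf2 dg1 cg1).
  by congr weak_deriv; apply/funext => x; rewrite ?(ImD, ImM); ring.
Qed.

Lemma weak_derivative_C1 f g : is_cderive f g -> ccontinuous g -> weak_derivative f g.
Proof.
move=> [d1 d2] [c1 c2]; apply/weak_derivativeP; split.
  exact: weak_deriv_C1 d1 c1.
exact: weak_deriv_C1 d2 c2.
Qed.

Lemma weak_derivative_unique f g1 g2 : cL1 g1 -> cL1 g2 ->
  weak_derivative f g1 -> weak_derivative f g2 -> aeq g1 g2.
Proof.
move=> [r1 i1] [r2 i2] /weak_derivativeP[wr1 wi1] /weak_derivativeP[wr2 wi2].
apply: (ae_mono2 (weak_deriv_unique r1 r2 wr1 wr2) (weak_deriv_unique i1 i2 wi1 wi2)).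
by move=> x h1 h2 Ix; apply: complex_ext; [exact: h1|exact: h2].
Qed.

Lemma aeq_sym f g : aeq f g -> aeq g f.
Proof. by move=> fg; apply: (ae_mono fg) => x h Ix; rewrite h. Qed.

Lemma aeq_trans f g h : aeq f g -> aeq g h -> aeq f h.
Proof. by move=> fg gh; apply: (ae_mono2 fg gh) => x e1 e2 Ix; rewrite e1 ?e2. Qed.

Lemma aeqW f g : (forall x, I01 x -> f x = g x) -> aeq f g.
Proof. by move=> fg; apply: aeW. Qed.

Lemma aeq_lin a f f' g g' : aeq f f' -> aeq g g' ->
  aeq (fun x => a * f x + g x) (fun x => a * f' x + g' x).
Proof. by move=> ff gg; apply: (ae_mono2 ff gg) => x e1 e2 Ix; rewrite e1 ?e2. Qed.

Lemma weak_derivative_aeq f f' g g' : cL1 f -> cL1 f' -> cL1 g -> cL1 g' ->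
  aeq f f' -> aeq g g' -> weak_derivative f g -> weak_derivative f' g'.
Proof.
move=> [f1 f2] [f'1 f'2] [g1 g2] [g'1 g'2] ff gg /weak_derivativeP[w1 w2].
have E (h k r : R -> R) : L1 h -> L1 k -> {ae mu, forall x, I01 x -> h x = k x} ->
    continuous r ->
    \int[mu]_(x in I01) (h x * r x) = \int[mu]_(x in I01) (k x * r x).
{ move=> h1 k1 hk cr; congr fine; apply: ae_eq_integral => //.
  - by apply/measurable_EFinP; apply: L1_measurable; exact: L1_mulr.
  - by apply/measurable_EFinP; apply: L1_measurable; exact: L1_mulr.
  - by apply: (ae_mono hk) => x e Ix; rewrite e. }
apply/weak_derivativeP; split => phi tp; have cp := test_continuous tp;
  have cp' : continuous phi^`()%classic by case: tp.
- rewrite -(E _ _ _ f1 f'1 _ cp'); last by apply: (ae_mono ff) => x e Ix; rewrite e.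
  by rewrite (w1 _ tp) (E _ _ _ g1 g'1 _ cp)//; apply: (ae_mono gg) => x e Ix; rewrite e.
- rewrite -(E _ _ _ f2 f'2 _ cp'); last by apply: (ae_mono ff) => x e Ix; rewrite e.
  by rewrite (w2 _ tp) (E _ _ _ g2 g'2 _ cp)//; apply: (ae_mono gg) => x e Ix; rewrite e.
Qed.

(** The lemma of du Bois-Reymond. *)
Lemma weak_derivative0_cst f : cL1 f -> weak_derivative f (fun=> 0) ->
  exists C : R[i], aeq f (fun=> C).
Proof.
move=> [f1 f2] /weak_derivativeP[w1 w2].
have i0 : L1 (fun=> 0 : R) by apply: L1_continuous; exact: cst_continuous.
have [C1 h1] := weak_deriv_primitive f1 i0 w1.
have [C2 h2] := weak_deriv_primitive f2 i0 w2.
exists (C1 +i* C2).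
apply: (ae_mono2 h1 h2) => x e1 e2 Ix.
have P0 y : parameterized_integral mu 0 y (fun=> 0) = 0.
  by rewrite /parameterized_integral Rintegral_cst// mul0r.
by apply: complex_ext; rewrite /= ?(e1 Ix) ?(e2 Ix) P0 addr0.
Qed.

End ComplexSobolev.

(** * The space H^1 and its traces *)

Section SobolevOne.
Context {R : realType}.
Implicit Types f g w : R -> R[i].
Implicit Types (a z : R[i]).
Local Notation mu := (@lebesgue_measure R).
Local Notation I01 := (`]0%R, 1%R[%classic : set R).
Local Notation Re := complex.Re.
Local Notation Im := complex.Im.

Lemma L2P f : L2 f <-> [/\ measurable_fun I01 (fun x => Re (f x)),
  measurable_fun I01 (fun x => Im (f x)) & L1 (fun x => Re (f x) ^+ 2 + Im (f x) ^+ 2)].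
Proof.
have E : (\int[mu]_(x in I01) (Normc.normc (f x) ^+ 2)%:E =
    \int[mu]_(x in I01) `|(EFin \o (fun x => (Re (f x) ^+ 2 + Im (f x) ^+ 2)%R)) x|)%E.
  apply: eq_integral => x _; rewrite normc_sqr /= ger0_norm//.
  by rewrite addr_ge0 ?sqr_ge0.
split=> [[m1 m2 foo]|[m1 m2 /integrableP[_ foo]]]; split => //; last by rewrite E.
apply/integrableP; split; last by rewrite -E.
by apply/measurable_EFinP; apply: measurable_funD; exact: measurable_funX.
Qed.

Lemma L1_le (f g : R -> R) : measurable_fun I01 f -> L1 g ->
  (forall x, `|f x| <= g x) -> L1 f.
Proof.
move=> mf g1 fg; apply: (le_integrable measurable_I01 _ _ g1); first exact/measurable_EFinP.
by move=> x _; rewrite /= lee_fin (le_trans (fg x))// ler_norm.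
Qed.

Lemma L1_cst (k : R) : L1 (fun=> k).
Proof. by apply: L1_continuous; exact: cst_continuous. Qed.

(** On a set of finite measure, |x| <= 1 + x^2 suffices. *)
Lemma L2_cL1 f : L2 f -> cL1 f.
Proof.
move=> /L2P[m1 m2 i]; have i' := L1D (L1_cst 1) i.
split; apply: (L1_le _ i') => // x.
  by rewrite ler_norml; apply/andP; split; nra.
by rewrite ler_norml; apply/andP; split; nra.
Qed.

Lemma normc_sqr_lin_le a z1 z2 : let n z := Re z ^+ 2 + Im z ^+ 2 in
  n (a * z1 + z2) <= 2 * n a * n z1 + 2 * n z2.
Proof.
rewrite /= !(ReD, ImD, ReM, ImM).
move: (Re a) (Im a) (Re z1) (Im z1) (Re z2) (Im z2) => p q x y u v.
have := sqr_ge0 (p * x - q * y - u); have := sqr_ge0 (p * y + q * x - v); nra.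
Qed.

Lemma L2_lin a f g : L2 f -> L2 g -> L2 (fun x => a * f x + g x).
Proof.
move=> f2 g2; have [fr fi] := L2_cL1 f2; have [gr gi] := L2_cL1 g2.
have [hr hi] := cL1_lin a (conj fr fi) (conj gr gi).
move: f2 g2 => /L2P[_ _ f2] /L2P[_ _ g2].
have [m1 m2] := (L1_measurable hr, L1_measurable hi).
apply/L2P; split => //.
apply: (L1_le _ (L1D (L1Z (2 * (Re a ^+ 2 + Im a ^+ 2)) f2) (L1Z 2 g2))).
  by apply: measurable_funD; exact: measurable_funX.
by move=> x; rewrite ger0_norm ?addr_ge0 ?sqr_ge0//; exact: normc_sqr_lin_le.
Qed.

Lemma ccontinuous_L2 f : ccontinuous f -> L2 f.
Proof.
move=> [c1 c2]; apply/L2P; split.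
- exact: continuous_measurable01.
- exact: continuous_measurable01.
- by apply: L1_continuous => x; apply: cvgD; apply: cvgM; (exact: c1 || exact: c2).
Qed.

Lemma H1_L2 f : H1 f -> L2 f. Proof. by case. Qed.

Lemma wderivP f : H1 f -> L2 (wderiv f) /\ weak_derivative f (wderiv f).
Proof. by move=> [_ ex]; exact: (xgetPex (fun=> 0) ex). Qed.

Lemma wderivE f g : H1 f -> cL1 g -> weak_derivative f g -> aeq (wderiv f) g.
Proof.
move=> /wderivP[d2 df] g2 fg.
by apply: weak_derivative_unique fg => //; exact: L2_cL1.
Qed.

Lemma H1_lin a f g : H1 f -> H1 g -> H1 (fun x => a * f x + g x) /\
  aeq (wderiv (fun x => a * f x + g x)) (fun x => a * wderiv f x + wderiv g x).
Proof.
move=> Hf Hg; have [f2 df] := wderivP Hf; have [g2 dg] := wderivP Hg.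
have cf := L2_cL1 (H1_L2 Hf); have cg := L2_cL1 (H1_L2 Hg).
have wl : weak_derivative (fun x => a * f x + g x) (fun x => a * wderiv f x + wderiv g x).
  by apply: weak_derivative_lin => //; exact: L2_cL1.
have HH : H1 (fun x => a * f x + g x).
  split; first by apply: L2_lin; exact: H1_L2.
  by exists (fun x => a * wderiv f x + wderiv g x); split => //; exact: L2_lin.
split => //; apply: wderivE => //; apply: cL1_lin; exact: L2_cL1.
Qed.

Lemma C1_H1 f g : is_cderive f g -> ccontinuous g -> H1 f /\ aeq (wderiv f) g.
Proof.
move=> dfg cg; have wfg := weak_derivative_C1 dfg cg.
have Hf : H1 f.
  split; first by apply: ccontinuous_L2; exact: is_cderive_continuous dfg.
  by exists g; split => //; exact: ccontinuous_L2.
by split => //; apply: wderivE => //; apply: L2_cL1; exact: ccontinuous_L2.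
Qed.

Definition cont_rep f w : Prop :=
  [/\ {within `[0, 1], continuous (fun x : R => Re (w x) : R)},
      {within `[0, 1], continuous (fun x : R => Im (w x) : R)} & aeq f w].

Lemma within_linear (p q : R) (h k : R -> R) :
  {within `[0, 1], continuous h} -> {within `[0, 1], continuous k} ->
  {within `[0, 1], continuous (fun x => p * h x + q * k x)}.
Proof.
move=> /subspace_continuousP ch /subspace_continuousP ck.
apply/subspace_continuousP => x x01; apply: cvgD; apply: cvgM;
  by [exact: cvg_cst|exact: ch|exact: ck].
Qed.

Lemma cont_rep_unique f w1 w2 : cont_rep f w1 -> cont_rep f w2 ->
  forall x, 0 <= x <= 1 -> w1 x = w2 x.
Proof.
move=> [r1 i1 e1] [r2 i2 e2] x x01.
have e12 := aeq_trans (aeq_sym e1) e2.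
have h (h k : R -> R) : {within `[0, 1], continuous h} -> {within `[0, 1], continuous k} ->
    {ae mu, forall x, I01 x -> h x = k x} -> h x = k x.
  move=> ch ck hk; apply/eqP; rewrite -subr_eq0; apply/eqP.
  rewrite -[h x]mul1r -[- k x]mulN1r.
  apply: (@within_ae_eq0 _ (fun x => 1 * h x + -1 * k x)) => //.
    exact: within_linear.
  by apply: (ae_mono hk) => y e Iy; rewrite e// mul1r mulN1r subrr.
apply: complex_ext.
  by apply: (h (fun x => Re (w1 x)) (fun x => Re (w2 x)) r1 r2); apply: (ae_mono e12) => y e Iy; rewrite e.
by apply: (h (fun x => Im (w1 x)) (fun x => Im (w2 x)) i1 i2); apply: (ae_mono e12) => y e Iy; rewrite e.
Qed.

Lemma traceE f w x : cont_rep f w -> 0 <= x <= 1 -> trace f x = w x.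
Proof.
move=> fw x01; apply: cont_rep_unique x01; last exact: fw.
exact: (@xgetPex _ (fun=> 0) [set w | cont_rep f w] (ex_intro _ w fw)).
Qed.

(** The primitive of the weak derivative, up to a constant. *)
Lemma H1_cont_rep f : H1 f -> exists w, cont_rep f w.
Proof.
move=> Hf; have [d2 /weak_derivativeP[wr wi]] := wderivP Hf.
have [dr di] := L2_cL1 d2; have [fr fi] := L2_cL1 (H1_L2 Hf).
have [C1 h1] := weak_deriv_primitive fr dr wr; have [C2 h2] := weak_deriv_primitive fi di wi.
have cP (C : R) h : L1 h -> {within `[0, 1], continuous (fun x => C + parameterized_integral mu 0 x h)}.
  move=> h1'; apply/subspace_continuousP => x x01; apply: cvgD; first exact: cvg_cst.
  by move: x x01; apply/subspace_continuousP; apply: parameterized_integral_continuous => //; exact: L1_cc.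
exists (fun x => (C1 + parameterized_integral mu 0 x (fun x => Re (wderiv f x))) +i*
                 (C2 + parameterized_integral mu 0 x (fun x => Im (wderiv f x)))).
split; [exact: cP|exact: cP|].
by apply: (ae_mono2 h1 h2) => x e1 e2 Ix; apply: complex_ext; rewrite ?e1 ?e2.
Qed.

Lemma cont_rep_lin a f g w v : cont_rep f w -> cont_rep g v ->
  cont_rep (fun x => a * f x + g x) (fun x => a * w x + v x).
Proof.
move=> [r1 i1 e1] [r2 i2 e2]; split; last exact: aeq_lin.
- have -> : (fun x => Re (a * w x + v x)) =
      (fun x => 1 * (Re a * Re (w x) + - Im a * Im (w x)) + 1 * Re (v x)).
    by apply/funext => x; rewrite ReD ReM; ring.
  by do 2! apply: within_linear => //.
- have -> : (fun x => Im (a * w x + v x)) =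
      (fun x => 1 * (Re a * Im (w x) + Im a * Re (w x)) + 1 * Im (v x)).
    by apply/funext => x; rewrite ImD ImM; ring.
  by do 2! apply: within_linear => //.
Qed.

Lemma trace_lin a f g x : H1 f -> H1 g -> 0 <= x <= 1 ->
  trace (fun x => a * f x + g x) x = a * trace f x + trace g x.
Proof.
move=> /H1_cont_rep[w fw] /H1_cont_rep[v gv] x01.
by rewrite (traceE fw x01) (traceE gv x01) (traceE (cont_rep_lin a fw gv) x01).
Qed.

Lemma ccontinuous_rep f w : ccontinuous w -> aeq f w -> cont_rep f w.
Proof. by move=> [c1 c2] fw; split => //; exact: continuous_subspaceT. Qed.

End SobolevOne.

(** * The energy space *)

Section EnergySpace.
Context {R : realType}.
Implicit Types f g w : R -> R[i].
Implicit Types (a z : R[i]).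
Local Notation mu := (@lebesgue_measure R).
Local Notation I01 := (`]0%R, 1%R[%classic : set R).
Local Notation Re := complex.Re.
Local Notation Im := complex.Im.

Lemma L2sqE f : L2sq f = \int[mu]_(x in I01) (Re (f x) ^+ 2 + Im (f x) ^+ 2).
Proof. by apply: eq_Rintegral => x _; rewrite normc_sqr. Qed.

Lemma L2sq_ge0 f : 0 <= L2sq f.
Proof. by apply: Rintegral_ge0 => x _; rewrite sqr_ge0. Qed.

Lemma L2_int f : L2 f -> L1 (fun x => Re (f x) ^+ 2 + Im (f x) ^+ 2).
Proof. by move=> /L2P[]. Qed.

Lemma L2sq_aeq f g : L2 f -> L2 g -> aeq f g -> L2sq f = L2sq g.
Proof.
move=> /L2_int/L1_measurable f2 /L2_int/L1_measurable g2 fg; rewrite !L2sqE; congr fine.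
apply: ae_eq_integral => //; try exact/measurable_EFinP.
by apply: (ae_mono fg) => x e Ix; rewrite e.
Qed.

Lemma L2sqZ a f : L2 f -> L2sq (fun x => a * f x) = Normc.normc a ^+ 2 * L2sq f.
Proof.
move=> /L2_int f2; rewrite !L2sqE -RintegralZl//; apply: eq_Rintegral => x _.
by rewrite normc_sqr ReM ImM; ring.
Qed.

Lemma sqr_young (e x y : R) : 0 < e -> (x + y) ^+ 2 <= (1 + e) * x ^+ 2 + (1 + e^-1) * y ^+ 2.
Proof.
move=> e0; rewrite -subr_ge0.
have -> : (1 + e) * x ^+ 2 + (1 + e^-1) * y ^+ 2 - (x + y) ^+ 2 = e^-1 * (e * x - y) ^+ 2.
  by field; rewrite gt_eqF.
by rewrite mulr_ge0 ?sqr_ge0// invr_ge0 ltW.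
Qed.

Lemma L2D f g : L2 f -> L2 g -> L2 (fun x => f x + g x).
Proof.
move=> f2 g2; have := L2_lin 1 f2 g2.
by congr L2; apply/funext => x; rewrite mul1r.
Qed.

Lemma L2Z a f : L2 f -> L2 (fun x => a * f x).
Proof.
move=> f2; have g2 : L2 (fun=> 0 : R[i]) by apply: ccontinuous_L2; split; exact: cst_continuous.
by have := L2_lin a f2 g2; congr L2; apply/funext => x; rewrite addr0.
Qed.

(** Unlike the triangle inequality, this weighted form is additive, so it passes
    to the sum over the components and the edges; [sqrt_triangle] recovers the
    triangle inequality from it at the very end. *)
Lemma L2sq_young (e : R) f g : 0 < e -> L2 f -> L2 g ->
  L2sq (fun x => f x + g x) <= (1 + e) * L2sq f + (1 + e^-1) * L2sq g.
Proof.
move=> e0 f2 g2; rewrite !L2sqE -!RintegralZl//; try exact: L2_int.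
rewrite -RintegralD//; try by apply: L1Z; exact: L2_int.
apply: le_Rintegral => //.
- by apply: L2_int; exact: L2D.
- by apply: L1D; apply: L1Z; exact: L2_int.
- move=> x _; rewrite ReD ImD.
  have := sqr_young (Re (f x)) (Re (g x)) e0; have := sqr_young (Im (f x)) (Im (g x)) e0.
  by lra.
Qed.

Lemma L2sq_eq0 f : L2 f -> L2sq f = 0 -> aeq f (fun=> 0).
Proof.
move=> f2; have i := L2_int f2; rewrite L2sqE /Rintegral => h.
have h0 : (\int[mu]_(x in I01) `|(Re (f x) ^+ 2 + Im (f x) ^+ 2)%:E| = 0)%E.
  under eq_integral do rewrite /= ger0_norm ?addr_ge0 ?sqr_ge0//.
  by rewrite -(fineK (integrable_fin_num _ i))// h.
have /(ae_eq_integral_abs mu measurable_I01) : measurable_fun I01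
    (EFin \o (fun x => Re (f x) ^+ 2 + Im (f x) ^+ 2)).
  by apply/measurable_EFinP; exact: L1_measurable.
move=> /iffLR /(_ h0) h1; apply: (ae_mono h1) => x e Ix.
have := e Ix; rewrite /= => -[/eqP]; rewrite paddr_eq0 ?sqr_ge0// !sqrf_eq0.
by move=> /andP[/eqP e1 /eqP e2]; apply: complex_ext.
Qed.

(** The optimal weight is the quotient of the two square roots; both are shifted
    by eps / 2 so that neither of them vanishes. *)
Lemma sqrt_triangle (A B C : R) : 0 <= A -> 0 <= B ->
  (forall e, 0 < e -> C <= (1 + e) * A + (1 + e^-1) * B) ->
  Num.sqrt C <= Num.sqrt A + Num.sqrt B.
Proof.
move=> A0 B0 h; apply/ler_addgt0Pr => eps eps0.
pose s := Num.sqrt A + eps / 2; pose t := Num.sqrt B + eps / 2.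
have s0 : 0 < s by rewrite ltr_wpDl ?sqrtr_ge0//; lra.
have t0 : 0 < t by rewrite ltr_wpDl ?sqrtr_ge0//; lra.
have -> : Num.sqrt A + Num.sqrt B + eps = s + t by rewrite /s /t; field.
have st0 : 0 <= s + t by lra.
rewrite -(ger0_norm st0) -sqrtr_sqr ler_wsqrtr//.
have As : A <= s ^+ 2.
  by rewrite -[leLHS](sqr_sqrtr A0) lerXn2r ?nnegrE ?sqrtr_ge0 ?(ltW s0)//; rewrite /s; lra.
have Bt : B <= t ^+ 2.
  by rewrite -[leLHS](sqr_sqrtr B0) lerXn2r ?nnegrE ?sqrtr_ge0 ?(ltW t0)//; rewrite /t; lra.
apply: le_trans; first by apply: (h (t / s)); exact: divr_gt0.
have -> : (s + t) ^+ 2 = (1 + t / s) * s ^+ 2 + (1 + (t / s)^-1) * t ^+ 2.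
  by field; rewrite !gt_eqF.
have ts : 0 < t / s by exact: divr_gt0.
by apply: lerD; apply: ler_wpM2l => //; [lra|rewrite addr_ge0// invr_ge0 ltW].
Qed.

Section States.
Context {n : nat}.
Implicit Types U V : state R n.

Lemma eqH_sym U V : eqH U V -> eqH V U.
Proof. by move=> h i; have [h1 h2] := h i; split; exact: aeq_sym. Qed.

Lemma eqH_trans U V W : eqH U V -> eqH V W -> eqH U W.
Proof.
move=> h k i; have [h1 h2] := h i; have [k1 k2] := k i.
by split; [exact: aeq_trans k1|exact: aeq_trans k2].
Qed.

Lemma eqH_lin a U U' V V' : eqH U U' -> eqH V V' -> eqH (a *: U + V) (a *: U' + V').
Proof.
by move=> h k i; have [h1 h2] := h i; have [k1 k2] := k i; split; exact: aeq_lin.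
Qed.

Lemma H0_lin a U V : H0 U -> H0 V -> H0 (a *: U + V).
Proof.
move=> [HU tU rU] [HV tV rV].
have t01 : 0 <= (0:R) <= 1 by rewrite lexx ler01.
have t11 : 0 <= (1:R) <= 1 by rewrite lexx ler01.
have tr i x : 0 <= x <= 1 -> trace ((a *: U + V) i).1 x = a * trace (U i).1 x + trace (V i).1 x.
  by move=> x01; apply: trace_lin => //; [case: (HU i)|case: (HV i)].
split.
- move=> i; have [U1 U2] := HU i; have [V1 V2] := HV i; split.
    by case: (H1_lin a U1 V1).
  exact: L2_lin.
- by move=> i i0; rewrite !tr// tU// tV.
- by rewrite tr// rU rV mulr0 addr0.
Qed.

Lemma H0_0 : H0 (0 : state R n).
Proof.
have c0 : ccontinuous (fun=> 0 : R[i]) by split; exact: cst_continuous.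
have t0 : forall x : R, 0 <= x <= 1 -> trace (fun=> 0 : R[i]) x = 0.
  by move=> x; apply: traceE; apply: ccontinuous_rep => //; exact: aeqW.
have [h0 _] : H1 (fun=> 0 : R[i]) /\ aeq (wderiv (fun=> 0)) (fun=> 0 : R[i]).
  by apply: C1_H1 => //; split => x; exact: is_derive_cst.
split => [i|i _|].
- by split => //; exact: ccontinuous_L2.
- by transitivity (0 : R[i]); [apply: t0|apply/esym/t0]; rewrite lexx ler01.
- by apply: t0; rewrite lexx ler01.
Qed.

Lemma H0Z a U : H0 U -> H0 (a *: U).
Proof. by move=> HU; have := H0_lin a HU H0_0; rewrite addr0. Qed.

Lemma normH_ge0 U : 0 <= normH U. Proof. exact: sqrtr_ge0. Qed.

Lemma wderiv_L2 f : H1 f -> L2 (wderiv f). Proof. by move=> /wderivP[]. Qed.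

Lemma wderiv_aeq f g : H1 f -> H1 g -> aeq f g -> aeq (wderiv f) (wderiv g).
Proof.
move=> Hf Hg fg; have [g2 dg] := wderivP Hg.
apply: wderivE => //; first exact: L2_cL1.
apply: weak_derivative_aeq dg; try by [exact: L2_cL1|exact: L2_cL1 (H1_L2 _)|apply: aeqW|exact: aeq_sym].
Qed.

Definition energy U : R :=
  \sum_(i < n.+2) (L2sq (U i).1 + L2sq (wderiv (U i).1) + L2sq (U i).2).

Lemma energy_ge0 U : 0 <= energy U.
Proof. by apply: sumr_ge0 => i _; rewrite !addr_ge0 ?L2sq_ge0. Qed.

Lemma normH_eqH U V : H0 U -> H0 V -> eqH U V -> normH U = normH V.
Proof.
move=> [HU _ _] [HV _ _] UV; congr Num.sqrt; apply: eq_bigr => i _.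
have [U1 U2] := HU i; have [V1 V2] := HV i; have [e1 e2] := UV i.
rewrite (L2sq_aeq (H1_L2 U1) (H1_L2 V1) e1) (L2sq_aeq U2 V2 e2).
by rewrite (L2sq_aeq (wderiv_L2 U1) (wderiv_L2 V1) (wderiv_aeq U1 V1 e1)).
Qed.

Lemma wderivD f g : H1 f -> H1 g ->
  H1 (fun x => f x + g x) /\ aeq (wderiv (fun x => f x + g x)) (fun x => wderiv f x + wderiv g x).
Proof.
move=> Hf Hg; have := H1_lin 1 Hf Hg.
have E h k : (fun x : R => 1 * h x + k x) = (fun x => h x + k x) :> (R -> R[i]).
  by apply/funext => x; rewrite mul1r.
by rewrite !E.
Qed.

Lemma H1_cst0 : H1 (fun=> 0 : R[i]).
Proof. by have [/(_ ord0)[]] := H0_0. Qed.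

Lemma wderivZ a f : H1 f ->
  H1 (fun x => a * f x) /\ aeq (wderiv (fun x => a * f x)) (fun x => a * wderiv f x).
Proof.
move=> Hf; have := H1_lin a Hf H1_cst0.
have E h : (fun x : R => a * h x + 0) = (fun x => a * h x) :> (R -> R[i]).
  by apply/funext => x; rewrite addr0.
rewrite E => -[HH h]; split => //; apply: aeq_trans h _.
have c0 : ccontinuous (fun=> 0 : R[i]) by split; exact: cst_continuous.
have [_ w0] : H1 (fun=> 0 : R[i]) /\ aeq (wderiv (fun=> 0)) (fun=> 0 : R[i]).
  by apply: C1_H1 => //; split => x; exact: is_derive_cst.
by apply: (ae_mono w0) => x e Ix; rewrite e// addr0.
Qed.

Lemma normHZ a U : H0 U -> normH (a *: U) = Normc.normc a * normH U.
Proof.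
move=> [HU _ _]; have na : 0 <= Normc.normc a by case: a => p q; exact: sqrtr_ge0.
rewrite -[X in X * _](ger0_norm na) -sqrtr_sqr -sqrtrM ?sqr_ge0//; congr Num.sqrt.
rewrite mulr_sumr; apply: eq_bigr => i _; have [U1 U2] := HU i.
have [Ha Ea] := wderivZ a U1.
rewrite !mulrDr -!L2sqZ//; [|exact: wderiv_L2|exact: H1_L2].
congr (_ + _ + _); apply: L2sq_aeq => //; first exact: wderiv_L2.
by apply: L2Z; exact: wderiv_L2.
Qed.

Lemma le_lincomb3 (p q a b c a' b' c' x y z : R) :
  x <= p * a + q * a' -> y <= p * b + q * b' -> z <= p * c + q * c' ->
  x + y + z <= p * (a + b + c) + q * (a' + b' + c').
Proof. by rewrite !mulrDr; lra. Qed.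

Lemma normHD U V : H0 U -> H0 V -> normH (U + V) <= normH U + normH V.
Proof.
move=> [HU _ _] [HV _ _]; apply: sqrt_triangle; try exact: energy_ge0.
move=> e e0; rewrite !mulr_sumr -big_split /=; apply: ler_sum => i _.
have [U1 U2] := HU i; have [V1 V2] := HV i.
have [Hs Es] := wderivD U1 V1.
have h1 := L2sq_young e0 (H1_L2 U1) (H1_L2 V1).
have h2 := L2sq_young e0 U2 V2.
have h3 := L2sq_young e0 (wderiv_L2 U1) (wderiv_L2 V1).
rewrite -(L2sq_aeq (wderiv_L2 Hs) (L2D (wderiv_L2 U1) (wderiv_L2 V1)) Es) in h3.
exact: le_lincomb3 h1 h3 h2.
Qed.

Lemma normH_eq0 U : H0 U -> normH U = 0 -> eqH U 0.
Proof.
move=> [HU _ _] /eqP; rewrite sqrtr_eq0 => e0.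
have e1 : energy U == 0 by rewrite eq_le e0 energy_ge0.
move: e1; rewrite psumr_eq0 => [/allP h|i _]; last by rewrite !addr_ge0 ?L2sq_ge0.
move=> i; have [U1 U2] := HU i; have := h i (mem_index_enum i).
rewrite /= paddr_eq0 ?addr_ge0 ?L2sq_ge0// paddr_eq0 ?L2sq_ge0//.
move=> /andP[/andP[/eqP h1 _] /eqP h2].
by split; apply: L2sq_eq0 => //; exact: H1_L2.
Qed.

End States.
End EnergySpace.

(** * Eigenvectors obstruct finite-time stabilization *)

Section FiniteTime.
Context {R : realType} {n : nat}.
Implicit Types (U V W : state R n) (S : R -> state R n -> state R n).
Local Notation normc := Normc.normc.

Lemma normc_ge0 (a : R[i]) : 0 <= normc a.
Proof. by case: a => p q; exact: sqrtr_ge0. Qed.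

Lemma normc_real (r : R) : normc r%:C = `|r|.
Proof. by rewrite /= expr0n addr0 sqrtr_sqr. Qed.

Lemma normc_geB (a b : R[i]) : normc a - normc b <= normc (a + b).
Proof.
rewrite lerBlDr; have := le_normcD (a + b) (- b).
by rewrite normcN addrK.
Qed.

(** Linearity is assumed for combinations a U + V only, hence the detour through
    (a - 1) U + U. *)
Lemma semigroup_scale S t (a : R[i]) U : C0_semigroup S -> 0 <= t -> H0 U ->
  eqH (S t (a *: U)) (a *: S t U).
Proof.
move=> [/(_ t) h _ _ _] t0 HU; have [_ _ + _] := h t0.
have E V : (a - 1) *: V + V = a *: V by rewrite -{2}[V]scale1r -scalerDl subrK.
by move=> /(_ (a - 1) U U HU HU); rewrite !E.
Qed.

(** By homogeneity, stability of the origin bounds S t uniformly in t >= 0. *)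
Lemma stable_bound S (delta r t : R) W : C0_semigroup S -> 0 < delta -> 0 < r -> 0 <= t ->
  (forall U, H0 U -> normH U < delta -> forall t, 0 <= t -> normH (S t U) < 1) ->
  H0 W -> normH W < r -> normH (S t W) < r / delta.
Proof.
move=> hS d0 r0 t0 st HW Wr.
have ap : 0 < delta / r by exact: divr_gt0.
have HS V : H0 V -> H0 (S t V) by move=> HV; case: hS => /(_ t t0)[+ _ _ _] _ _ _; apply.
have : normH (S t ((delta / r)%:C *: W)) < 1.
  apply: st => //; first exact: H0Z.
  by rewrite normHZ// normc_real gtr0_norm// mulrAC ltr_pdivrMr// ltr_pM2l.
rewrite (normH_eqH (HS _ (H0Z _ HW)) (H0Z _ (HS _ HW)) (semigroup_scale _ hS t0 HW)).
rewrite normHZ ?normc_real ?gtr0_norm//; last exact: HS.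
by rewrite -ltr_pdivlMl// mulr1 invf_div.
Qed.

(** For an eigenvector, S h U = (1 + h lam) U + o(h). Applying S (k h), whose norm
    is bounded uniformly in k, each step of length h shrinks the norm of the
    trajectory at most by the factor 1 - |lam| h, up to an error o(h). Over a fixed
    time these errors add up to o(1) while the product of the factors stays above
    exp(- 2 |lam| T): the trajectory cannot reach 0 unless U = 0. *)
Theorem eigenvector_not_finite_time (c : 'I_n.+2 -> R) (alpha : R) (lam : R[i]) S U :
  C0_semigroup S -> generator (domAD c alpha) (AD c) S ->
  domAD c alpha U -> eqH (AD c U) (lam *: U) -> finite_time_stable S -> eqH U 0.
Proof.
move=> hS hG dU eU [stab fin].
have HU : H0 U by case: dU.
have HA : H0 (AD c U).
{ case: dU => _ [Hr [_ v0] _ _ tr]; split.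
  - move=> i; have [[H1u H1w] H1v] := Hr i; split => //.
    by apply: L2Z; exact: wderiv_L2.
  - by move=> i i0; have [] := tr i i0.
  - exact: v0. }
have [delta d0 hd] := stab 1 ltr01.
have [T T0 hT] := fin U HU.
have [hS1 _ hS3 _] := hS.
have HS t V : 0 <= t -> H0 V -> H0 (S t V) by move=> /hS1[+ _ _ _] HV; apply.
apply: normH_eq0 => //; apply/eqP; rewrite eq_le normH_ge0 andbT.
pose L := normc lam; have L0 : 0 <= L by exact: normc_ge0.
(* A positive time is needed in order to divide it into steps. *)
pose T1 := T + 1; have T10 : 0 < T1 by rewrite /T1; lra.
have key eps : 0 < eps -> expR (- 2 * L * T1) * normH U <= T1 * eps / delta.
  move=> eps0.
  have lim : normH ((h^-1)%:C *: (S h U - U) - AD c U) @[h --> (0 : R)^'+] --> (0 : R).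
    by apply/(hG U (AD c U) HU HA); split => // i; split; exact: aeqW.
  have [m [m0 [hm hL]]] : exists m : nat, (0 < m)%N /\
     (normH (((T1 / m%:R)^-1)%:C *: (S (T1 / m%:R) U - U) - AD c U) < eps /\
      L * (T1 / m%:R) <= 2^-1).
    have /cvgrPdist_lt/(_ _ eps0) lim0 := lim.
    have lim' : \forall h \near (0:R)^'+, L * h <= 2^-1 /\
        `|0 - normH ((h^-1)%:C *: (S h U - U) - AD c U)| < eps.
      near=> h; split; last by near: h.
      have L10 : 0 < L + 1 by lra.
      have : h <= 2^-1 / (L + 1).
        by near: h; apply: nbhs_right_le; rewrite divr_gt0//; lra.
      rewrite ler_pdivlMr// => hL; have h0 : 0 < h by near: h; exact: nbhs_right_gt.
      rewrite mulrDr mulr1 in hL; rewrite mulrC; by apply: le_trans hL; rewrite lerDl ltW.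
    have [d /= dp hdd] := lim'.
    have [m hm] : exists m : nat, T1 / d < m%:R by exists (Num.truncn (T1 / d)).+1; exact: truncnS_gt.
    have mr0 : 0 < (m%:R : R) by apply: le_lt_trans hm; rewrite divr_ge0 ?ltW.
    have hpos : 0 < T1 / m%:R by exact: divr_gt0.
    have hlt : T1 / m%:R < d by rewrite ltr_pdivrMr// mulrC -ltr_pdivrMr.
    have hb : ball_ Num.norm 0 d (T1 / m%:R) by rewrite /ball_ /= sub0r normrN gtr0_norm.
    have [h1] := hdd _ hb hpos; rewrite sub0r normrN ger0_norm ?normH_ge0// => h2.
    by exists m; rewrite -(ltr0n R).
  set h := T1 / m%:R in hm hL.
  have mr0 : 0 < (m%:R : R) by rewrite ltr0n.
  have h0 : 0 < h by exact: divr_gt0.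
  pose mu := 1 + h%:C * lam.
  pose D := S h U - mu *: U.
  have HSU : H0 (S h U) by apply: HS => //; exact: ltW.
  have HD : H0 D by rewrite /D addrC -scaleNr; exact: H0_lin.
  have Dn : normH D < h * eps.
    pose Q := (h^-1)%:C *: (S h U - U) - AD c U.
    have HQ : H0 Q.
      rewrite /Q -[- AD c U]scaleN1r addrC; apply: H0_lin => //; apply: H0Z.
      by rewrite addrC -scaleN1r; exact: H0_lin.
    have eD : eqH D (h%:C *: Q).
      have -> : D = (- h%:C) *: (lam *: U) + (S h U - U).
        rewrite /D /mu scalerDl scale1r scalerA mulNr scaleNr opprD.
        by rewrite addrA [RHS]addrC.
      have -> : h%:C *: Q = (- h%:C) *: AD c U + (S h U - U).
        rewrite /Q scalerBr scalerA -rmorphM /= divff ?gt_eqF// scale1r.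
        by rewrite scaleNr [RHS]addrC.
      by apply: eqH_lin; [exact: eqH_sym|move=> i; split; exact: aeqW].
    rewrite (normH_eqH HD (H0Z _ HQ) eD) normHZ// normc_real gtr0_norm//.
    by rewrite ltr_pM2l.
  have mu1 : 1 - L * h <= normc mu.
    have := normc_geB 1 (h%:C * lam).
    by rewrite Normc.normc1 Normc.normcM normc_real gtr0_norm// [h * _]mulrC.
  have step k : (1 - L * h) ^+ k * normH U - k%:R * (h * eps / delta) <= normH (S (k%:R * h) U).
    elim: k => [|k IH].
      rewrite expr0 mul1r !mul0r subr0.
      case: hS => _ + _ _ => /(_ U HU) e0.
      by rewrite (normH_eqH (HS _ _ (lexx 0) HU) HU e0).
    have kh0 : 0 <= k%:R * h by rewrite mulr_ge0// ltW.
    have HSk := HS _ _ kh0 HU.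
    have Dk := stable_bound hS d0 (mulr_gt0 h0 eps0) kh0 hd HD Dn.
    have HSD := HS _ _ kh0 HD.
    have eS : eqH (S (k.+1%:R * h) U) (mu *: S (k%:R * h) U + S (k%:R * h) D).
      have -> : k.+1%:R * h = k%:R * h + h by rewrite -natr1 mulrDl mul1r.
      apply: eqH_trans; first exact: (hS3 _ _ _ kh0 (ltW h0) HU).
      have -> : S h U = mu *: U + D by rewrite /D addrC subrK.
      by have [_ _ + _] := hS1 _ kh0; apply.
    have k1h0 : 0 <= k.+1%:R * h by rewrite mulr_ge0// ltW.
    rewrite (normH_eqH (HS _ _ k1h0 HU) (H0_lin _ HSk HSD) eS).
    have := normHD (H0_lin mu HSk HSD) (H0Z (-1) HSD).
    rewrite scaleN1r addrK normHZ// -scaleN1r normHZ//.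
    rewrite normcN Normc.normc1 mul1r => tri.
    rewrite -natr1 exprS.
    have x1 : 0 <= 1 - L * h by lra.
    have IH2 := ler_wpM2l x1 IH.
    have nS := normH_ge0 (S (k%:R * h) U).
    have IH3 := ler_wpM2r nS mu1.
    have q0 : 0 <= h * eps / delta by exact: divr_ge0 (mulr_ge0 (ltW h0) (ltW eps0)) (ltW d0).
    have q1 : 0 <= k%:R * (h * eps / delta) by rewrite mulr_ge0.
    have Lh0 : 0 <= L * h by rewrite mulr_ge0// ltW.
    have Lq : 0 <= (L * h) * (k%:R * (h * eps / delta)) by rewrite mulr_ge0.
    move: IH2 IH3 Dk tri q0 q1 Lq; clear.
    move: ((1 - L * h) ^+ k) (normH U) (k%:R) (h * eps / delta) => P N K Q.
    move: (normH _) (normH _) (normH _) (normc mu) (L * h) => a b e f g.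
    by lra.
  have := step m; have -> : m%:R * h = T1 by rewrite /h mulrC divfK// gt_eqF.
  have -> : normH (S T1 U) = 0.
    have T10' : 0 <= T1 by exact: ltW.
    have e0 : eqH (S T1 U) 0 by apply: hT; rewrite /T1; lra.
    rewrite (normH_eqH (HS _ _ T10' HU) H0_0 e0).
    by have := normHZ 0 (@H0_0 R n); rewrite scale0r Normc.normc0 mul0r.
  rewrite subr_le0 => fin1.
  (* It follows from 1 - x >= exp(- 2 x), valid for 0 <= x <= 1/2. *)
  have xb : expR (- 2 * L * T1) <= (1 - L * h) ^+ m.
    have -> : - 2 * L * T1 = (- 2 * (L * h)) * m%:R.
      by rewrite /h; field; rewrite gt_eqF.
    rewrite expRM_natr; apply: lerXn2r; rewrite ?nnegrE ?expR_ge0//; first by lra.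
    have x0 : 0 <= L * h by rewrite mulr_ge0// ltW.
    have -> : - 2 * (L * h) = - (2 * (L * h)) by rewrite mulNr.
    rewrite expRN -[leLHS]mul1r ler_pdivrMr ?expR_gt0//.
    have := expR_ge1Dx (2 * (L * h)); move: x0 hL (expR _); clear.
    move: (L * h) => x x0 x1 y yx; nra.
  have -> : T1 * eps / delta = m%:R * (h * eps / delta).
    by rewrite /h; field; rewrite !gt_eqF.
  by apply: le_trans fin1; apply: ler_wpM2r => //; exact: normH_ge0.
rewrite leNgt; apply/negP => N0.
have E0 := expR_gt0 (- 2 * L * T1).
have EN := mulr_gt0 E0 N0.
have e0 : 0 < expR (- 2 * L * T1) * normH U * delta / (2 * T1).
  by rewrite divr_gt0// mulr_gt0.
have := key _ e0.
have -> : T1 * (expR (- 2 * L * T1) * normH U * delta / (2 * T1)) / delta =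
   expR (- 2 * L * T1) * normH U / 2 by field; rewrite !gt_eqF.
move: EN; clear; move: (_ * normH U) => x; lra.
Unshelve. all: try by end_near.
Qed.

End FiniteTime.

(** * The complex exponential *)

Section ComplexExponential.
Context {R : realType}.
Implicit Types (z w : R[i]) (x : R).
Local Notation Re := complex.Re.
Local Notation Im := complex.Im.

Definition cexp z : R[i] := (expR (Re z) * cos (Im z)) +i* (expR (Re z) * sin (Im z)).

Lemma cexpD z w : cexp (z + w) = cexp z * cexp w.
Proof.
by apply: complex_ext; rewrite ?(ReM, ImM) /cexp /= ReD ImD expRD ?cosD ?sinD; ring.
Qed.

Lemma cexp0 : cexp 0 = 1.
Proof. by rewrite /cexp /= expR0 cos0 sin0 mulr0 mulr1. Qed.

Lemma cexp_neq0 z : cexp z != 0.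
Proof.
apply/eqP => h; have := cexpD z (- z); rewrite subrr cexp0 h mul0r => /eqP.
by rewrite oner_eq0.
Qed.

Lemma cexpN z : cexp (- z) = (cexp z)^-1.
Proof.
by apply: (mulfI (cexp_neq0 z)); rewrite -cexpD subrr cexp0 divff// cexp_neq0.
Qed.

Lemma cexp2 z : cexp (2 * z) = cexp z ^+ 2.
Proof. by rewrite mulr_natl mulr2n cexpD expr2. Qed.

Lemma is_cderive_cexp z :
  is_cderive (fun x : R => cexp (z * x%:C)) (fun x => z * cexp (z * x%:C)).
Proof.
case: z => p q; have E : (fun x : R => cexp ((p +i* q) * x%:C)) =
    (fun x => (expR (p * x) * cos (q * x)) +i* (expR (p * x) * sin (q * x))).
  by apply/funext => x; rewrite /cexp ReM ImM /= !mulr0 subr0 add0r.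
have dl (k x : R) : is_derive x 1 (fun y : R => k * y) k.
  by apply: is_derive_eq; rewrite /GRing.scale /= mulr1.
have de (x : R) := @is_derive1_comp _ expR (fun y => p * y) x _ _ (is_derive_expR (p * x)) (dl p x).
have dc (x : R) := @is_derive1_comp _ cos (fun y => q * y) x _ _ (is_derive_cos (q * x)) (dl q x).
have ds (x : R) := @is_derive1_comp _ sin (fun y => q * y) x _ _ (is_derive_sin (q * x)) (dl q x).
split => x; rewrite (congr1 (@^~ x) E).
- rewrite (_ : (fun x : R => Re (cexp ((p +i* q) * x%:C))) =
    (fun x => (expR \o (fun y => p * y)) x * (cos \o (fun y => q * y)) x)); last first.
    by apply/funext => y; rewrite (congr1 (@^~ y) E).
  apply: (is_derive_eq (is_deriveM (de x) (dc x))).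
  by rewrite ReM /= /GRing.scale /=; ring.
- rewrite (_ : (fun x : R => Im (cexp ((p +i* q) * x%:C))) =
    (fun x => (expR \o (fun y => p * y)) x * (sin \o (fun y => q * y)) x)); last first.
    by apply/funext => y; rewrite (congr1 (@^~ y) E).
  apply: (is_derive_eq (is_deriveM (de x) (ds x))).
  by rewrite ImM /= /GRing.scale /=; ring.
Qed.

Lemma ccontinuous_lin z (f g : R -> R[i]) : ccontinuous f -> ccontinuous g ->
  ccontinuous (fun x => z * f x + g x).
Proof.
move=> [f1 f2] [g1 g2]; split.
- under eq_fun do rewrite ReD ReM.
  by move=> x; apply: cvgD; [apply: cvgB; apply: cvgM; by [exact: cvg_cst|exact: f1|exact: f2]|exact: g1].
- under eq_fun do rewrite ImD ImM.
  by move=> x; apply: cvgD; [apply: cvgD; apply: cvgM; by [exact: cvg_cst|exact: f1|exact: f2]|exact: g2].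
Qed.

Lemma ccontinuous_cst z : ccontinuous (fun=> z : R[i]).
Proof. by split; exact: cst_continuous. Qed.

Lemma is_cderive_lin z (f f' g g' : R -> R[i]) : is_cderive f f' -> is_cderive g g' ->
  is_cderive (fun x => z * f x + g x) (fun x => z * f' x + g' x).
Proof.
move=> [f1 f2] [g1 g2]; split => x.
- rewrite (_ : (fun x => Re (z * f x + g x)) =
      (fun x => Re z * Re (f x) - Im z * Im (f x) + Re (g x))); last first.
    by apply/funext => y; rewrite ReD ReM.
  have h1 := f1 x; have h2 := f2 x; have h3 := g1 x.
  by apply: is_derive_eq; rewrite ReD ReM /GRing.scale /=; ring.
- rewrite (_ : (fun x => Im (z * f x + g x)) =
      (fun x => Re z * Im (f x) + Im z * Re (f x) + Im (g x))); last first.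
    by apply/funext => y; rewrite ImD ImM.
  have h1 := f1 x; have h2 := f2 x; have h3 := g2 x.
  by apply: is_derive_eq; rewrite ImD ImM /GRing.scale /=; ring.
Qed.

Lemma is_cderive_cst z : is_cderive (fun=> z : R[i]) (fun=> 0).
Proof. by split => x; exact: is_derive_cst. Qed.

Lemma periodicz (f : R -> R) (T : R) (k : int) (a : R) :
  periodic f T -> f (a + T *~ k) = f a.
Proof.
move=> fT; case: k => m; first by rewrite -pmulrn periodicn.
by rewrite NegzE mulrNz -pmulrn -[LHS](periodicn fT m.+1) subrK.
Qed.

(** Reduce t to s in [0, 2 pi[; then 1 - cos s = 2 sin (s / 2) ^ 2, and the sine
    does not vanish on ]0, pi[. *)
Lemma cos_eq1_period (t : R) : cos t = 1 -> exists k : int, t = (pi *+ 2) *~ k.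
Proof.
move=> ct; have p0 : 0 < pi *+ 2 :> R by rewrite pmulrn_lgt0// pi_gt0.
pose k := Num.floor (t / (pi *+ 2)); exists k; apply/eqP; rewrite -subr_eq0.
pose s := t - (pi *+ 2) *~ k.
have cs : cos s = 1 by rewrite /s -mulrNz periodicz//; exact: cosD2pi.
have s0 : 0 <= s.
  rewrite /s subr_ge0 -mulrzr -ler_pdivlMl// mulrC.
  exact: floor_le.
have s1 : s < pi *+ 2.
  have := floorD1_gt (t / (pi *+ 2)); rewrite -/k intrD ltr_pdivrMr// mulrDl mul1r.
  by rewrite /s -[X in t - X]mulrzr ltrBlDr [_ * (pi *+ 2)]mulrC addrC.
have [//|sn0] := eqVneq s 0.
have : 0 < sin (s / 2).
  apply: sin_gt0_pi; apply/andP; split; last by rewrite ltr_pdivrMr// mulr_natr.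
  by rewrite divr_gt0// lt_def sn0.
have := cos_mulr2n (s / 2); rewrite -[(s / 2) *+ 2]mulr_natr divfK// cs cos2sin2 => h sp.
have : sin (s / 2) ^+ 2 = 0 by lra.
by move/eqP; rewrite sqrf_eq0 gt_eqF.
Qed.

End ComplexExponential.

(** * The logarithm and the eigenvalue equation on an edge *)

Section Spectrum.
Context {R : realType}.
Implicit Types (z w mu nu A B : R[i]) (f g : R -> R[i]).
Local Notation Re := complex.Re.
Local Notation Im := complex.Im.
Local Notation I01 := (`]0%R, 1%R[%classic : set R).

(** On the real line the chosen determination of the argument is 0 or pi, and
    [cexp] has period 2 i pi. *)
Lemma cexp_eq_real w (r : R) : r != 0 ->
  cexp w = r%:C <-> exists k : int, w = log_mhalfpi r%:C + 0 +i* ((pi *+ 2) *~ k).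
Proof.
move=> r0.
have nr : 0 < `|r| by rewrite normr_gt0.
pose th : R := if 0 < r then 0 else pi.
have E : log_mhalfpi r%:C = ln `|r| +i* th.
  rewrite /log_mhalfpi normc_real; congr Complex.
  rewrite /arg_mhalfpi /= mul0r atan0 /th.
  by case: ltrgt0P r0 => //; rewrite ?eqxx// => _ _; rewrite add0r.
have cth : `|r| * cos th = r /\ sin th = 0.
  rewrite /th; case: ltrgt0P r0 => [rp|rn|->]; rewrite ?eqxx// => _.
    by rewrite cos0 sin0 mulr1.
  by rewrite cospi sinpi mulrN1 opprK.
rewrite E; split; last first.
  move=> [k ->]; apply: complex_ext; rewrite /= ?addr0 lnK ?posrE//.
    by rewrite (periodicz k th (@cosD2pi R)) cth.1.
  by rewrite (periodicz k th (@sinD2pi R)) cth.2 mulr0.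
move=> ew; have eR := congr1 (@complex.Re R) ew; have eI := congr1 (@complex.Im R) ew.
case: w {ew} eR eI => a b /= eR eI.
have sb : sin b = 0.
  by move/eqP: eI; rewrite mulf_eq0 gt_eqF ?expR_gt0//= => /eqP.
have ea : expR a = `|r|.
  by rewrite -eR normrM (gtr0_norm (expR_gt0 a)) (sin0cos1 sb) mulr1.
have cb : cos (b - th) = 1.
  rewrite cosB sb mul0r addr0.
  have n2 : `|r| ^+ 2 != 0 by rewrite expf_neq0// gt_eqF.
  apply: (mulfI n2); rewrite mulr1 -{1}ea.
  have -> : expR a ^+ 2 * (cos b * cos th) = (expR a * cos b) * (expR a * cos th) by ring.
  by rewrite eR ea cth.1 -expr2 real_normK// num_real.
have [k ek] := cos_eq1_period cb; exists k.
by apply: complex_ext; rewrite /= ?addr0 -?ek; [rewrite -ea expRK|ring].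
Qed.

Lemma lambda_cexp n (c : 'I_n.+2 -> R) (alpha : R) lam (N := n.+2%:R : R) :
  0 < c ord0 -> (N - 2 - alpha) / (N - alpha) != 0 ->
  (exists k : int, lam = lambda c alpha k) <->
  cexp (2 * (lam / (c ord0)%:C)) = ((N - 2 - alpha) / (N - alpha))%:C.
Proof.
move=> c0 r0; have c1 : (c ord0)%:C != 0 by rewrite eq_complex /= eqxx andbT gt_eqF.
apply: iff_trans (iff_sym (cexp_eq_real _ r0)).
have n2 : (2 : R[i]) != 0 by rewrite pnatr_eq0.
have E k : lambda c alpha k = (c ord0)%:C / 2 *
    (log_mhalfpi ((N - 2 - alpha) / (N - alpha))%:C + 0 +i* ((pi *+ 2) *~ k)).
  rewrite /lambda -/N [RHS]mulrDr.
  have -> : (c ord0)%:C / 2 = (c ord0 / 2)%:C.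
    by rewrite rmorphM /= fmorphV /= rmorph_nat.
    congr (_ + _); apply: complex_ext; rewrite ?(ReM, ImM) /=; first by ring.
  by rewrite -[(pi *+ 2) *~ k]mulrzr -[pi *+ 2]mulr_natr; field.
split=> -[k].
  by move=> ->; exists k; rewrite E; field.
by move=> h; exists k; rewrite E -h; field.
Qed.

Definition wave A B mu (x : R) : R[i] := A * cexp (mu * x%:C) + B * cexp (- mu * x%:C).

(** The function w = nu f + g solves the first order equation w' = nu w, so
    exp(- nu x) w has derivative 0. *)
Lemma ode_factor nu f g : cL1 f -> cL1 g -> weak_derivative f g ->
  weak_derivative g (fun x => nu ^+ 2 * f x) ->
  exists C, aeq (fun x => nu * f x + g x) (fun x => C * cexp (nu * x%:C)).
Proof.
move=> f1 g1 fg gf.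
have nf1 : cL1 (fun x => nu ^+ 2 * f x).
  have := cL1_lin (nu ^+ 2) f1 (L2_cL1 (ccontinuous_L2 (ccontinuous_cst 0))).
  by under eq_fun do rewrite addr0.
have w1 := cL1_lin nu f1 g1.
have w'1 := cL1_lin nu g1 nf1.
have wD := weak_derivative_lin nu f1 g1 g1 nf1 fg gf.
have eD := is_cderive_cexp (- nu).
have eC : ccontinuous (fun x => - nu * cexp (- nu * x%:C)).
  have := ccontinuous_lin (- nu) (is_cderive_continuous eD) (ccontinuous_cst 0).
  by under eq_fun do rewrite addr0.
have wE := weak_derivativeM w1 w'1 wD eD eC.
have w0 : weak_derivative (fun x => (nu * f x + g x) * cexp (- nu * x%:C)) (fun=> 0).
  by move: wE; congr weak_derivative; apply/funext => x; ring.
have [C hC] := weak_derivative0_cst (cL1_mul w1 (is_cderive_continuous eD)) w0.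
exists C; apply: (ae_mono hC) => x e Ix.
by rewrite -(e Ix) mulNr cexpN divfK// cexp_neq0.
Qed.

(** Factor the equation f'' = mu^2 f as (d/dx - mu) (d/dx + mu) f = 0: applying
    [ode_factor] with nu = mu and with nu = - mu determines g + mu f and g - mu f. *)
Lemma ode_wave mu f g : mu != 0 -> cL1 f -> cL1 g -> weak_derivative f g ->
  weak_derivative g (fun x => mu ^+ 2 * f x) ->
  exists A B, aeq f (wave A B mu) /\ aeq g (wave (mu * A) (- mu * B) mu).
Proof.
move=> mu0 f1 g1 fg gf.
have [C hC] := ode_factor f1 g1 fg gf.
have [D hD] : exists D, aeq (fun x => - mu * f x + g x) (fun x => D * cexp (- mu * x%:C)).
  by apply: ode_factor => //; rewrite sqrrN.
have n2 : (2 : R[i]) != 0 by rewrite pnatr_eq0.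
exists (C / (2 * mu)), (- D / (2 * mu)); split;
  apply: (ae_mono2 hC hD) => x e1 e2 Ix; have {}e1 := e1 Ix; have {}e2 := e2 Ix; rewrite /wave.
- have -> : C / (2 * mu) * cexp (mu * x%:C) + - D / (2 * mu) * cexp (- mu * x%:C) =
     (C * cexp (mu * x%:C) - D * cexp (- mu * x%:C)) / (2 * mu) by ring.
  by rewrite -e1 -e2; field.
- have -> : mu * (C / (2 * mu)) * cexp (mu * x%:C) + - mu * (- D / (2 * mu)) * cexp (- mu * x%:C) =
     (C * cexp (mu * x%:C) + D * cexp (- mu * x%:C)) / 2 by field.
  by rewrite -e1 -e2; field.
Qed.

(** The double root mu = 0, which [ode_wave] excludes. *)
Lemma weak_affine f g : cL1 f -> cL1 g -> weak_derivative f g ->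
  weak_derivative g (fun=> 0) ->
  exists C D, aeq f (fun x => C * x%:C + D) /\ aeq g (fun=> C).
Proof.
move=> f1 g1 fg g0; have [C hC] := weak_derivative0_cst g1 g0.
have c1 : cL1 (fun=> C) by apply: L2_cL1; apply: ccontinuous_L2; exact: ccontinuous_cst.
have fC := weak_derivative_aeq f1 f1 g1 c1 (aeqW (fun x _ => erefl)) hC fg.
have dx : is_cderive (fun x : R => x%:C) (fun=> 1) by split => x; [exact: is_derive_id|exact: is_derive_cst].
have cx := is_cderive_continuous dx.
have x1 := L2_cL1 (ccontinuous_L2 cx).
have one1 := L2_cL1 (ccontinuous_L2 (ccontinuous_cst (1 : R[i]))).
have xC := weak_derivative_C1 dx (ccontinuous_cst 1).
have w := weak_derivative_lin (- C) x1 one1 f1 c1 xC fC.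
have w0 : weak_derivative (fun x => - C * x%:C + f x) (fun=> 0).
  by move: w; congr weak_derivative; apply/funext => x; ring.
have [D hD] := weak_derivative0_cst (cL1_lin (- C) x1 f1) w0.
exists C, D; split => //; apply: (ae_mono hD) => x e Ix.
by rewrite -(e Ix); ring.
Qed.

End Spectrum.

(** * The characteristic equation *)

Section Eigenvalues.
Context {R : realType}.
Implicit Types (z w mu nu A B lam : R[i]) (f g : R -> R[i]).
Local Notation I01 := (`]0%R, 1%R[%classic : set R).

Lemma ccontinuous_cexp mu : ccontinuous (fun x : R => cexp (mu * x%:C)).
Proof. exact: is_cderive_continuous (is_cderive_cexp mu). Qed.

Lemma ccontinuous_wave A B mu : ccontinuous (wave A B mu).
Proof.
apply: ccontinuous_lin; first exact: ccontinuous_cexp.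
have := ccontinuous_lin B (ccontinuous_cexp (- mu)) (ccontinuous_cst 0).
by under eq_fun do rewrite addr0.
Qed.

Lemma is_cderive_wave A B mu : is_cderive (wave A B mu) (wave (mu * A) (- mu * B) mu).
Proof.
have h := is_cderive_lin A (is_cderive_cexp mu)
  (is_cderive_lin B (is_cderive_cexp (- mu)) (is_cderive_cst 0)).
have -> : wave A B mu = fun x => A * cexp (mu * x%:C) + (B * cexp (- mu * x%:C) + 0).
  by apply/funext => x; rewrite addr0.
have -> : wave (mu * A) (- mu * B) mu = fun x => A * (mu * cexp (mu * x%:C)) +
    (B * (- mu * cexp (- mu * x%:C)) + 0).
  by apply/funext => x; rewrite /wave; ring.
exact: h.
Qed.

Lemma wave0 A B mu : wave A B mu 0 = A + B.
Proof. by rewrite /wave !mulr0 cexp0 !mulr1. Qed.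

Lemma wave1 A B mu : wave A B mu 1 = A * cexp mu + B / cexp mu.
Proof. by rewrite /wave !mulr1 cexpN. Qed.

Lemma wave_H2 A B mu (u := wave A B mu) :
  [/\ H2 u, aeq (wderiv u) (wave (mu * A) (- mu * B) mu) &
      aeq (wderiv (wderiv u)) (fun x => mu ^+ 2 * u x)].
Proof.
have [Hu du] := C1_H1 (is_cderive_wave A B mu) (ccontinuous_wave _ _ _).
have [d2 _] := wderivP Hu.
set u' := wave (mu * A) (- mu * B) mu in du.
have c' : cL1 u' by apply: L2_cL1; apply: ccontinuous_L2; exact: ccontinuous_wave.
have E : wave (mu * (mu * A)) (- mu * (- mu * B)) mu = fun x => mu ^+ 2 * u x.
  by apply/funext => x; rewrite /u /wave; ring.
have L2u : L2 (fun x => mu ^+ 2 * u x) by rewrite -E; apply: ccontinuous_L2; exact: ccontinuous_wave.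
have w : weak_derivative (wderiv u) (fun x => mu ^+ 2 * u x).
  have w' := weak_derivative_C1 (is_cderive_wave (mu * A) (- mu * B) mu) (ccontinuous_wave _ _ _).
  rewrite E in w'; apply: weak_derivative_aeq w' => //; try exact: L2_cL1.
    exact: aeq_sym.
  exact: aeqW.
have Hu' : H1 (wderiv u) by split => //; exists (fun x => mu ^+ 2 * u x).
by split => //; apply: wderivE => //; exact: L2_cL1.
Qed.

Lemma trace_wave f A B mu : aeq f (wave A B mu) ->
  trace f 0 = A + B /\ trace f 1 = A * cexp mu + B / cexp mu.
Proof.
move=> h; have r := ccontinuous_rep (ccontinuous_wave A B mu) h.
by rewrite (traceE r) ?lexx ?ler01// wave0 (traceE r) ?lexx ?ler01// wave1.
Qed.

Lemma real_complex_neq0 (r : R) : r != 0 -> r%:C != 0 :> R[i].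
Proof. by move=> r0; rewrite eq_complex /= eqxx andbT. Qed.

(** The node condition for a root edge carrying the amplitudes a and - a, where E
    is the exponential at its far end: up to a nonzero factor it is the
    characteristic equation. *)
Lemma node_identity (M b E m a k : R[i]) : E != 0 ->
  (M - 1) * (- (k * m) * (a * (E - E^-1))) - k * (m * a * E + - m * - a / E)
   - - (b * (k * m * a * E + k * m * - a / E)) =
  - (k * m * a / E) * ((M - b) * E ^+ 2 - (M - 2 - b)).
Proof. by move=> E0; field. Qed.

Section Star.
Context {n : nat}.
Context (c : 'I_n.+2 -> R) (alpha : R) (hc : forall i, 0 < c i).
Let N : R := n.+2%:R.

Lemma speed_neq0 i : (c i)%:C != 0 :> R[i].
Proof. by apply: real_complex_neq0; rewrite gt_eqF. Qed.

Lemma sum_others (z : R[i]) : \sum_(i < n.+2 | i != ord0) z = (N%:C - 1) * z.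
Proof.
have : \sum_(i < n.+2) z = z *+ n.+2 by rewrite sumr_const card_ord.
rewrite (bigD1 ord0)//= => h.
by rewrite /N rmorph_nat mulrBl mul1r mulr_natl -h [X in _ = X - z]addrC addrK.
Qed.

Lemma eigen_edge lam (U : state R n) i : domAD c alpha U -> eqH (AD c U) (lam *: U) ->
  [/\ H1 (U i).1, L2 (wderiv (U i).1), weak_derivative (U i).1 (wderiv (U i).1),
    weak_derivative (wderiv (U i).1) (fun x => (lam / (c i)%:C) ^+ 2 * (U i).1 x) &
    aeq (U i).2 (fun x => lam * (U i).1 x)].
Proof.
move=> [[HU _ _] [Hr _ _ _ _]] eU; have [[Hu Hw] Hv] := Hr i.
have [u2 du] := wderivP Hu; have [w2 dw] := wderivP Hw.
have [e1 e2] := eU i; split => //.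
have k0 := speed_neq0 i.
have uL := H1_L2 Hu.
have m2 : L2 (fun x => (lam / (c i)%:C) ^+ 2 * (U i).1 x) by exact: L2Z.
apply: weak_derivative_aeq dw; try exact: L2_cL1; first exact: aeqW.
apply: (ae_mono2 e1 e2) => x h1 h2 Ix.
have {}h1 : (U i).2 x = lam * (U i).1 x := h1 Ix.
have {}h2 : (c i ^+ 2)%:C * wderiv (wderiv (U i).1) x = lam * (U i).2 x := h2 Ix.
have c2 : (c i ^+ 2)%:C != 0 :> R[i] by rewrite rmorphXn /= expf_neq0.
apply: (mulfI c2); rewrite h2 h1 rmorphXn /=.
by field.
Qed.

Lemma eigen_edge_wave lam (U : state R n) i : lam != 0 ->
  domAD c alpha U -> eqH (AD c U) (lam *: U) ->
  exists A B, let mu := lam / (c i)%:C in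
  [/\ aeq (U i).1 (wave A B mu),
      aeq (wderiv (U i).1) (wave (mu * A) (- mu * B) mu) &
      aeq (U i).2 (wave (lam * A) (lam * B) mu)].
Proof.
move=> l0 dU eU; have [Hu w2 du dw ev] := eigen_edge i dU eU.
have mu0 : lam / (c i)%:C != 0 by rewrite mulf_neq0// invr_eq0 speed_neq0.
have [A [B [hA hB]]] := ode_wave mu0 (L2_cL1 (H1_L2 Hu)) (L2_cL1 w2) du dw.
exists A, B; split => //.
by apply: (ae_mono2 hA ev) => x e1 e2 Ix; rewrite e2// e1// /wave; ring.
Qed.

(** For the eigenvalue 0 every component is affine. The transparent conditions make
    the outgoing ones constant, so the node condition kills the slope on the root
    edge; the Dirichlet condition and continuity then leave 0 everywhere. *)
Lemma AD_kernel_trivial (U : state R n) : domAD c alpha U -> eqH (AD c U) ((0 : R[i]) *: U) -> eqH U 0.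
Proof.
move=> dU eU; have [[_ tU rU] [_ _ ext node _]] := dU.
have K i : exists C D, [/\ aeq (U i).1 (fun x => C * x%:C + D), aeq (wderiv (U i).1) (fun=> C) &
    aeq (U i).2 (fun=> 0)].
  have [Hu w2 du dw ev] := eigen_edge i dU eU.
  have dw0 : weak_derivative (wderiv (U i).1) (fun=> 0).
    by move: dw; congr weak_derivative; apply/funext => x; rewrite mul0r expr0n mul0r.
  have [C [D [h1 h2]]] := weak_affine (L2_cL1 (H1_L2 Hu)) (L2_cL1 w2) du dw0.
  exists C, D; split => //.
  by apply: (ae_mono ev) => x e Ix; rewrite e// mul0r.
have [C KC] := choice K; have [D KCD] := choice KC.
have cx : ccontinuous (fun x : R => x%:C) by split => [x|x]; [exact: cvg_id|exact: cst_continuous].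
have r01 : 0 <= (0 : R) <= 1 by rewrite lexx ler01.
have r11 : 0 <= (1 : R) <= 1 by rewrite lexx ler01.
have tr i : [/\ trace (U i).1 0 = D i, trace (U i).1 1 = C i + D i,
    forall x, 0 <= x <= 1 -> trace (wderiv (U i).1) x = C i &
    forall x, 0 <= x <= 1 -> trace (U i).2 x = 0].
  have [h1 h2 h3] := KCD i.
  have ru := ccontinuous_rep (ccontinuous_lin (C i) cx (ccontinuous_cst (D i))) h1.
  have rw := ccontinuous_rep (ccontinuous_cst (C i)) h2.
  have rv := ccontinuous_rep (ccontinuous_cst (0 : R[i])) h3.
  have tw x : 0 <= x <= 1 -> trace (wderiv (U i).1) x = C i by exact: traceE rw.
  have tv x : 0 <= x <= 1 -> trace (U i).2 x = 0 by exact: traceE rv.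
  by split; rewrite ?(traceE ru r01) ?(traceE ru r11) ?mulr0 ?add0r ?mulr1.
have Ci i : i != ord0 -> C i = 0.
  move=> i0; have [_ _ tw tv] := tr i.
  have := ext i i0; rewrite tw// tv// oppr0 => /eqP.
  by rewrite mulf_eq0 (negbTE (speed_neq0 i)) => /eqP.
have [t0 t1 tw tv] := tr ord0.
have D0 : D ord0 = 0 by rewrite -t0.
have C0 : C ord0 = 0.
  move: node; rewrite big1; last first.
    by move=> i i0; have [_ _ twi _] := tr i; rewrite twi// Ci// mulr0.
  rewrite tw// tv// mulr0 oppr0 sub0r => /eqP; rewrite oppr_eq0 mulf_eq0.
  by rewrite (negbTE (speed_neq0 ord0)) => /eqP.
have C0' i : C i = 0 by have [->//|/Ci] := eqVneq i ord0.
have D0' i : D i = 0.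
  have [->//|i0] := eqVneq i ord0.
  by have [ti _ _ _] := tr i; rewrite -ti tU// t1 C0 D0 addr0.
move=> i; have [h1 h2 h3] := KCD i; split => //.
by apply: (ae_mono h1) => x e Ix; rewrite e// C0' D0' mul0r addr0.
Qed.

(** The transparent conditions leave only the outgoing exponential on the outer
    edges, the Dirichlet condition leaves a multiple of sinh on the root edge, and
    continuity expresses all amplitudes through that of the root edge, which
    therefore does not vanish. The node condition is then [node_identity]. *)
Lemma eigenvalue_characteristic lam : sigma_d c alpha lam ->
  (N - alpha)%:C * cexp (lam / (c ord0)%:C) ^+ 2 = (N - 2 - alpha)%:C.
Proof.
move=> [U [dU nU eU]].
have [l0|l0] := eqVneq lam 0; first by rewrite l0 in eU; case: nU; exact: AD_kernel_trivial dU eU.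
have [A KA] := choice (fun i => eigen_edge_wave i l0 dU eU); have [B KB] := choice KA.
have [[_ tU rU] [_ _ ext node _]] := dU.
pose mu i := lam / (c i)%:C; pose e i := cexp (mu i).
have e0 i : e i != 0 by exact: cexp_neq0.
have cmu i : (c i)%:C * mu i = lam by rewrite mulrC divfK// speed_neq0.
have t1 i : trace (U i).1 0 = A i + B i /\ trace (U i).1 1 = A i * e i + B i / e i.
  by have [h1 h2 h3] := KB i; exact: trace_wave.
have t2 i : trace (wderiv (U i).1) 0 = mu i * A i + - mu i * B i /\
    trace (wderiv (U i).1) 1 = mu i * A i * e i + - mu i * B i / e i.
  by have [h1 h2 h3] := KB i; exact: trace_wave.
have t3 i : trace (U i).2 0 = lam * A i + lam * B i /\
    trace (U i).2 1 = lam * A i * e i + lam * B i / e i.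
  by have [h1 h2 h3] := KB i; exact: trace_wave.
have A0 i : i != ord0 -> A i = 0.
  move=> i0; have := ext i i0; rewrite (t2 i).2 (t3 i).2 => h.
  have : 2 * lam * e i * A i = 0.
    apply/eqP; rewrite -(subrr (- (lam * A i * e i + lam * B i / e i))) -{1}h -(cmu i).
    by apply/eqP; ring.
  by move/eqP; rewrite !mulf_eq0 pnatr_eq0 (negbTE l0) (negbTE (e0 i)) => /eqP.
have B0 : B ord0 = - A ord0.
  by apply/eqP; rewrite -addr_eq0 addrC -(t1 ord0).1 rU.
have Bi i : i != ord0 -> B i = A ord0 * (e ord0 - (e ord0)^-1).
  move=> i0; have := tU i i0; rewrite (t1 i).1 (t1 ord0).2 A0// add0r B0 => ->.
  by rewrite mulrBr mulNr.
have a0 : A ord0 != 0.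
  apply/eqP => a0; apply: nU => i.
  have z : A i = 0 /\ B i = 0.
    have [->|i0] := eqVneq i ord0; first by rewrite B0 a0 oppr0.
    by rewrite A0// Bi// a0 mul0r.
  have [h1 _ h3] := KB i; rewrite z.1 z.2 in h1 h3.
  split; first by apply: (ae_mono h1) => x h Ix; rewrite h// /wave !mul0r addr0.
  by apply: (ae_mono h3) => x h Ix; rewrite h// /wave !mulr0 !mul0r addr0.
move: node; rewrite (eq_bigr (fun=> - lam * (A ord0 * (e ord0 - (e ord0)^-1)))); last first.
  by move=> i i0; rewrite (t2 i).1 A0// Bi// mulr0 add0r mulNr mulrN mulrA cmu mulNr.
rewrite -/(mu ord0) -/(e ord0).
rewrite sum_others (t2 ord0).2 (t3 ord0).2 B0 -(cmu ord0) => /eqP.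
rewrite -subr_eq0 node_identity// mulf_eq0 oppr_eq0.
have /negbTE -> : (c ord0)%:C * mu ord0 * A ord0 / e ord0 != 0.
  by rewrite !mulf_neq0// ?invr_eq0 ?speed_neq0// invr_eq0 speed_neq0.
by rewrite /= subr_eq0 !rmorphB /= !rmorph_nat => /eqP.
Qed.

(** The same computation read backwards, with amplitude 1 on the root edge. The
    characteristic equation excludes exp(2 lam / c_0) = 1, so neither lam nor the
    value of the eigenvector at the node vanishes. *)
Lemma characteristic_eigenvalue lam :
  (N - alpha)%:C * cexp (lam / (c ord0)%:C) ^+ 2 = (N - 2 - alpha)%:C ->
  sigma_d c alpha lam.
Proof.
pose mu i := lam / (c i)%:C; pose e i := cexp (mu i).
rewrite -/(mu ord0) -/(e ord0) !rmorphB /= [2%:C]rmorph_nat => h.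
have e0 i : e i != 0 by exact: cexp_neq0.
have e1 : e ord0 ^+ 2 != 1.
  apply/eqP => e1; move: h; rewrite e1 mulr1 => /eqP.
  rewrite -subr_eq0 (_ : _ - _ = 2); last by ring.
  by rewrite pnatr_eq0.
have l0 : lam != 0.
  by apply: contraNneq e1 => l0; rewrite /e /mu l0 mul0r cexp0 expr1n.
pose A (i : 'I_n.+2) : R[i] := if i == ord0 then 1 else 0.
pose B (i : 'I_n.+2) : R[i] := if i == ord0 then -1 else e ord0 - (e ord0)^-1.
pose U : state R n := fun i => (wave (A i) (B i) (mu i), wave (lam * A i) (lam * B i) (mu i)).
have cmu i : (c i)%:C * mu i = lam by rewrite mulrC divfK// speed_neq0.
have aeqr f : aeq f f by exact: aeqW.
have t1 i := trace_wave (aeqr (U i).1).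
have t3 i := trace_wave (aeqr (U i).2).
have W i := wave_H2 (A i) (B i) (mu i).
have t2 i : trace (wderiv (U i).1) 0 = mu i * A i + - mu i * B i /\
    trace (wderiv (U i).1) 1 = mu i * A i * e i + - mu i * B i / e i.
  by have [_ h2 _] := W i; exact: trace_wave.
have L2w a b m : L2 (wave a b m : R -> R[i]) by apply: ccontinuous_L2; exact: ccontinuous_wave.
have H1w a b m : H1 (wave a b m : R -> R[i]).
  by have [[]] := wave_H2 a b m.
have A0 i : i != ord0 -> A i = 0 by rewrite /A => /negbTE ->.
have B0 i : i != ord0 -> B i = e ord0 - (e ord0)^-1 by rewrite /B => /negbTE ->.
have Ao : A ord0 = 1 by [].
have Bo : B ord0 = -1 by [].
have tu i : i != ord0 -> trace (U i).1 0 = trace (U ord0).1 1.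
  by move=> i0; rewrite (t1 i).1 (t1 ord0).2 A0// B0// Ao Bo add0r mul1r mulN1r.
have tr : trace (U ord0).1 0 = 0 by rewrite (t1 ord0).1 Ao Bo subrr.
exists U; split.
- split; first by split => // i; split; [exact: H1w|exact: L2w].
  split => //.
  + by move=> i; have [h2 _ _] := W i; split; [exact: h2|exact: H1w].
  + by split => //; rewrite (t3 ord0).1 Ao Bo mulr1 mulrN1 subrr.
  + move=> i i0; rewrite (t2 i).2 (t3 i).2 A0// !mulr0 !mul0r !add0r.
    by rewrite -(cmu i); ring.
  + rewrite (eq_bigr (fun=> - lam * (A ord0 * (e ord0 - (e ord0)^-1)))); last first.
      by move=> i i0; rewrite (t2 i).1 A0// B0// Ao mulr0 add0r mulNr mulrN mulrA cmu mulNr mul1r.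
    rewrite sum_others (t2 ord0).2 (t3 ord0).2 -(cmu ord0).
    have -> : B ord0 = - A ord0 by rewrite Ao Bo.
    apply/eqP; rewrite -subr_eq0 node_identity// h subrr mulr0.
    by [].
  + move=> i i0; split; first exact: tu.
    by rewrite (t3 i).1 (t3 ord0).2 A0// B0// Ao Bo -/(e ord0); ring.
- move=> /(_ ord0)[z _].
  have := traceE (ccontinuous_rep (ccontinuous_cst (0 : R[i])) z) (x := 1).
  rewrite lexx ler01 => /(_ isT); rewrite (t1 ord0).2 Ao Bo mul1r mulN1r => /eqP.
  rewrite subr_eq0 => /eqP ee; move/eqP: e1; apply.
  by rewrite expr2 /e {2}ee divff// cexp_neq0.
- move=> i; have [_ _ h3] := W i; split.
    apply: aeqW => x _; suff : (U i).2 x = lam * (U i).1 x by [].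
    by rewrite /= /wave; ring.
  apply: (ae_mono h3) => x e3 Ix.
  suff : (c i ^+ 2)%:C * wderiv (wderiv (U i).1) x = lam * (U i).2 x by [].
  rewrite (e3 Ix : wderiv (wderiv (U i).1) x = _) rmorphXn /= mulrA -exprMn cmu /wave.
  ring.
Qed.
End Star.
End Eigenvalues.

Theorem proposition4p1 (R : realType) (n : nat) (c : 'I_n.+2 -> R)
    (alpha1 : R) (N := n.+2%:R : R)
    (hc : forall i, 0 < c i) (halpha1 : alpha1 <> N) :
  [/\ (exists lam : R[i], sigma_d c alpha1 lam) <-> alpha1 <> N - 2,
      alpha1 <> N - 2 ->
        sigma_d c alpha1 = [set lambda c alpha1 k | k in [set: int]] &
      alpha1 <> N - 2 ->
        forall S : R -> state R n -> state R n,
          C0_semigroup S -> generator (domAD c alpha1) (AD c) S ->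
          ~ finite_time_stable S].
Proof.
have D0 : N - alpha1 != 0 by rewrite subr_eq0; apply/eqP => /esym.
have DC0 : (N - alpha1)%:C != 0 :> R[i] by exact: real_complex_neq0.
have chr lam : alpha1 <> N - 2 ->
    sigma_d c alpha1 lam <-> exists k, lam = lambda c alpha1 k.
  move=> a2.
  have r0 : (N - 2 - alpha1) / (N - alpha1) != 0.
    by rewrite mulf_neq0 ?invr_eq0// subr_eq0; apply/eqP => /esym.
  rewrite (lambda_cexp lam (hc ord0) r0) cexp2.
  rewrite rmorphM /= fmorphV /=.
  split.
    move=> /(eigenvalue_characteristic hc) h; apply: (mulfI DC0).
    by rewrite h mulrCA divff// mulr1.
  move=> h; apply: (characteristic_eigenvalue hc).
  by rewrite h mulrCA divff// mulr1.
have ex : alpha1 <> N - 2 -> exists lam : R[i], sigma_d c alpha1 lam.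
  by move=> a2; exists (lambda c alpha1 0); apply/(chr _ a2); exists 0.
split.
- split=> [[lam /(eigenvalue_characteristic hc) h] a2|]; last exact: ex.
  move: h; rewrite a2 subrr => /eqP.
  rewrite mulf_eq0 expf_eq0/= (negbTE (cexp_neq0 _)) orbF -a2.
  by rewrite (negbTE DC0).
- move=> a2; apply/seteqP; split=> lam.
    by move=> /(chr _ a2)[k ->]; exists k.
  by move=> [k _ <-]; apply/(chr _ a2); exists k.
- move=> a2 S hS hG fts; have [lam [U [dU nU eU]]] := ex a2.
  exact: nU (eigenvector_not_finite_time hS hG dU eU fts).
Qed.
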